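(* In the model described in the context with full channel state information at the sensors, the antenna gain satisfies $$G_{\rm CSIS}(N)\le \zeta\,\frac{\mathcal{E}_{\rm CSIS}(N)}{\mathcal{E}_{\rm AWGN}(1)}\le \zeta\min\left[\frac{N(z+1)}{Nz+1},\ (z+1)\frac{NK+1}{K+1}\right],$$ where $z:=\gamma_{\rm c}/(p_1\gamma_{\rm s}+1)$.
   Context: Model: $L$ sensors observe $\Theta\in\{0,\theta\}$, $\theta>0$, with prior $P(\Theta=\theta)=p_1\in(0,1)$. Sensor $l$ observes $x_l=\Theta+\eta_l$, $\eta_l\sim\mathcal{CN}(0,\sigma_\eta^2)$ i.i.d., applies a complex gain $\alpha_l$, and transmits over a multiple-access channel to a fusion center with $N$ antennas, receiving $\mathbf{y}=\mathbf{H}\boldsymbol{\alpha}\Theta+\mathbf{H}\mathbf{D}(\boldsymbol{\alpha})\boldsymbol{\eta}+\boldsymbol{\nu}$, where $\mathbf{H}$ is $N\times L$ with i.i.d. entries $h_{nl}=\sqrt{K/(K+1)}+\frac{1}{\sqrt{K+1}}h^{\rm diff}_{nl}$, $h^{\rm diff}_{nl}$ i.i.d. zero-mean with unit second moment, $K\ge0$; $\mathbf{D}(\boldsymbol\alpha)=\mathrm{diag}(\boldsymbol\alpha)$; $\boldsymbol\nu\sim\mathcal{CN}(\mathbf 0,\sigma_\nu^2\mathbf I_N)$ independent of $\boldsymbol\eta$. Let $\mathbf{R}(\boldsymbol{\alpha})=\sigma_\eta^2\mathbf{H}\mathbf{D}(\boldsymbol{\alpha})\mathbf{D}(\boldsymbol{\alpha})^H\mathbf{H}^H+\sigma_\nu^2\mathbf{I}_N$,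 power constraint $\|\boldsymbol\alpha\|^2\le P:=P_T/(p_1\theta^2+\sigma_\eta^2)$, $P_T>0$. Sensing SNR $\gamma_{\rm s}=\theta^2/\sigma_\eta^2$, channel SNR $\gamma_{\rm c}=P_T/\sigma_\nu^2$. With full CSI at the sensors, $\boldsymbol\alpha_{\rm OPT}$ maximizes $\boldsymbol\alpha^H\mathbf{H}^H\mathbf{R}(\boldsymbol\alpha)^{-1}\mathbf{H}\boldsymbol\alpha$ subject to $\|\boldsymbol\alpha\|^2\le P$, and $\mathcal{E}_{\rm CSIS}(N)=\lim_{L\to\infty}\frac{\theta^2}{8}\frac1L\boldsymbol\alpha_{\rm OPT}^H\mathbf{H}^H\mathbf{R}(\boldsymbol\alpha_{\rm OPT})^{-1}\mathbf{H}\boldsymbol\alpha_{\rm OPT}$ (limit in probability); this is the error exponent $\lim_{L\to\infty}-\frac1L\log P_{e|\mathbf H}(N)$ of the Bayesian test at the fusion center. The antenna gain is $G_{\rm CSIS}(N)=\mathcal{E}_{\rm CSIS}(N)/\mathcal{E}_{\rm CSIS}(1)$. Further, $\mathcal{E}_{\rm AWGN}(1)=\frac18\frac{\gamma_{\rm c}\gamma_{\rm s}}{\gamma_{\rm c}+p_1\gamma_{\rm s}+1}$ is the error exponent for $N=1$ with all channels equal to $1$, and $\zeta=(E[|h_{nl}|])^{-2}$. *)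

(* Defs.v *)
(* mathcomp-analysis (probability) + real-closed (complex numbers). *)
From HB Require Import structures.
From mathcomp Require Import all_boot all_order all_algebra.
From mathcomp Require Import all_classical all_reals all_analysis.
From mathcomp Require Import complex.
Set Implicit Arguments. Unset Strict Implicit. Unset Printing Implicit Defensive.
Import Order.TTheory GRing.Theory Num.Theory.
Local Open Scope ring_scope.
Local Open Scope classical_set_scope.

Section Defs.
Variable R : realType.
Local Notation C := R[i].

(* modulus of a complex number, real-valued *)
Definition cabs (z : C) : R := Num.sqrt (complex.Re z ^+ 2 + complex.Im z ^+ 2).

(* squared Euclidean norm of a complex column vector *)
Definition sqnormc L (v : 'cV[C]_L) : R :=
  \sum_(l < L) (complex.Re (v l 0) ^+ 2 + complex.Im (v l 0) ^+ 2).

(* conjugate transpose *)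
Definition ctr m n (A : 'M[C]_(m, n)) : 'M[C]_(n, m) :=
  (map_mx (fun z => (z^*)%C) A)^T.

(* D(alpha) D(alpha)^H *)
Definition DDH L (a : 'cV[C]_L) : 'M[C]_L :=
  diag_mx (\row_l (a l 0 * (a l 0)^*)%C).

(* R(alpha) = s_eta^2 H D D^H H^H + s_nu^2 I_N  (s_eta2, s_nu2 are the variances) *)
Definition Rmat (s_eta2 s_nu2 : R) N L (H : 'M[C]_(N, L)) (a : 'cV[C]_L) : 'M[C]_N :=
  (s_eta2%:C)%C *: (H *m DDH a *m ctr H) + ((s_nu2%:C)%C)%:M.

(* alpha^H H^H R(alpha)^{-1} H alpha  (a real number; we take its real part) *)
Definition quadform (s_eta2 s_nu2 : R) N L (H : 'M[C]_(N, L)) (a : 'cV[C]_L) : R :=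
  complex.Re ((ctr a *m ctr H *m invmx (Rmat s_eta2 s_nu2 H a) *m H *m a) 0 0).

(* alpha maximizes the quadratic form subject to ||alpha||^2 <= Pw *)
Definition is_opt_gain (s_eta2 s_nu2 Pw : R) N L (H : 'M[C]_(N, L)) (a : 'cV[C]_L) :=
  sqnormc a <= Pw /\
  forall b : 'cV[C]_L, sqnormc b <= Pw -> quadform s_eta2 s_nu2 H b <= quadform s_eta2 s_nu2 H a.

(* the N x L channel matrix built from the first N rows and L columns of an array *)
Definition chanmx (T : Type) (h : nat -> nat -> T -> C) N L (w : T) : 'M[C]_(N, L) :=
  \matrix_(n < N, l < L) h n l w.

End Defs.

Section Prob.
Context (R : realType) (d : measure_display) (T : measurableType d) (P : probability T R).
Local Notation C := R[i].

(* event {Re X in A, Im X in B} *)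
Definition cevent (X : T -> C) (A B : set R) : set T :=
  [set w | A (complex.Re (X w)) /\ B (complex.Im (X w))].

(* measurability of a complex random variable (real and imaginary parts Borel) *)
Definition cmeasurable (X : T -> C) :=
  measurable_fun setT (fun w => complex.Re (X w)) /\
  measurable_fun setT (fun w => complex.Im (X w)).

(* mutual independence of a family of complex (= R^2-valued) random variables:
   product rule on every finite subfamily, for all measurable rectangles *)
Definition cindep (I : eqType) (X : I -> T -> C) :=
  forall (F : seq I), uniq F ->
  forall (A B : I -> set R), (forall i, measurable (A i) /\ measurable (B i)) ->
  P (\bigcap_(i in [set` F]) cevent (X i) (A i) (B i)) =
  (\prod_(i <- F) P (cevent (X i) (A i) (B i)))%E.

(* identical distribution (joint law of (Re, Im) on measurable rectangles) *)
Definition cident (I : Type) (X : I -> T -> C) :=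
  forall (i j : I) (A B : set R), measurable A -> measurable B ->
  P (cevent (X i) A B) = P (cevent (X j) A B).

(* convergence in probability of a real sequence of random variables to a constant *)
Definition cvg_in_prob (Y : nat -> T -> R) (c : R) :=
  forall eps : R, 0 < eps ->
  (fun L => P [set w | eps <= `|Y L w - c|]) @ \oo --> 0%E.

End Prob.

(* Main.v *)
Require Import Defs.
From HB Require Import structures.
From mathcomp Require Import all_boot all_order all_algebra.
From mathcomp Require Import all_classical all_reals all_analysis.
From mathcomp Require Import measurable_realfun complex ring lra.
Import Order.TTheory GRing.Theory Num.Theory numFieldNormedType.Exports.
Local Open Scope ring_scope.
Local Open Scope classical_set_scope.
Set Implicit Arguments. Unset Strict Implicit. Unset Printing Implicit Defensive.

(* Put x = R(a)^-1 H a and k_l = x^H h_l, where h_l is the l-th column of H, so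
   that the objective q equals sum_l a_l k_l and also
   s sum_l |a_l|^2 |k_l|^2 + v |x|^2.  Termwise AM-GM, with the power constraint
   used to spread v over the sensors, gives q <= sum_l phi(|h_l|^2) for
   phi(t) = t / (s t + v/Pw); for one antenna this is attained.
   - Concavity of phi bounds the mean of q / L by phi(N): first upper bound.
   - For N = 1, Cauchy-Schwarz gives E phi(|h|^2) >= (E|h|)^2 / (s + v/Pw):
     the bound by zeta.
   - AM-GM also gives q <= (Pw/v) lambda_max(H H^H), and H H^H / L tends to a
     matrix of top eigenvalue (N K + 1)/(K + 1): second upper bound.  Since the
     channel has only two moments, the diffuse part is truncated first.
   Limits in probability are compared with means, using that q / L lies between
   0 and random variables of controlled mean (or above ones that are bounded). *)

(** * Deterministic bounds on the quadratic form *)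

(** In these terms z = s Pw / v and the AWGN exponent is (theta^2 / 8) phi(1); hence the first bound
    is phi(N) / phi(1), and the factor z + 1 of the second is (Pw / v) / phi(1). Two features of the
    hypotheses shape the probabilistic part. The Gram matrix H H^H is quadratic in the channel, so
    controlling its variance would take fourth moments: truncation makes the entries bounded, and
    the discarded part needs only a small mean square. Independence holds between entries, not
    between the real and imaginary parts of one entry, so mixed products of the two parts are
    averaged only across different antennas; on the diagonal they cancel, because h conj(h) is
    real. *)

Section ComplexSquares.
Variable R : realType.
Local Notation C := R[i].
Local Notation Re := complex.Re.
Local Notation Im := complex.Im.

(** Real-valued, unlike the norm of [R[i]], and convertible to the summand of [sqnormc], so that the
    two are exchanged by folding. *)
Definition csq (z : C) : R := Re z ^+ 2 + Im z ^+ 2.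

Lemma csq_ge0 z : 0 <= csq z.
Proof. by rewrite addr_ge0 ?sqr_ge0. Qed.

Lemma csqM z w : csq (z * w) = csq z * csq w.
Proof. by case: z => a b; case: w => c e; rewrite /csq /=; ring. Qed.

Lemma csqZ (t : R) z : csq ((t%:C)%C * z) = t ^+ 2 * csq z.
Proof. by rewrite csqM {1}/csq /= expr0n addr0. Qed.

Lemma csqJ z : csq (z^*)%C = csq z.
Proof. by case: z => a b; rewrite /csq /= sqrrN. Qed.

Lemma csqE z : z * (z^*)%C = ((csq z)%:C)%C.
Proof. by case: z => a b; rewrite /csq /=; simpc; congr (_ +i* _)%C; ring. Qed.

Lemma csq0 z : csq z = 0 -> z = 0.
Proof.
case: z => a b /eqP; rewrite paddr_eq0 ?sqr_ge0 // !sqrf_eq0 /= => /andP[/eqP-> /eqP->].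
by [].
Qed.

Lemma cabs_ge0 (z : C) : 0 <= cabs z.
Proof. exact: sqrtr_ge0. Qed.

Lemma cabs_sqr (z : C) : cabs z ^+ 2 = csq z.
Proof. by rewrite sqr_sqrtr // csq_ge0. Qed.

Lemma cabsM (z w : C) : cabs (z * w) = cabs z * cabs w.
Proof. by rewrite /cabs -!/(csq _) csqM sqrtrM // csq_ge0. Qed.

Lemma Re_le_cabs (z : C) : Re z <= cabs z.
Proof.
have := cabs_ge0 z; have := cabs_sqr z; rewrite /csq => h1 h2; nra.
Qed.

Lemma ReD (z w : C) : Re (z + w) = Re z + Re w.
Proof. by case: z; case: w. Qed.
Lemma ImD (z w : C) : Im (z + w) = Im z + Im w.
Proof. by case: z; case: w. Qed.

Lemma Re_sum (I : Type) (r : seq I) (p : pred I) (F : I -> C) :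
  Re (\sum_(i <- r | p i) F i) = \sum_(i <- r | p i) Re (F i).
Proof. by elim/big_rec2: _ => // i x y _ <-; rewrite ReD. Qed.
Lemma Im_sum (I : Type) (r : seq I) (p : pred I) (F : I -> C) :
  Im (\sum_(i <- r | p i) F i) = \sum_(i <- r | p i) Im (F i).
Proof. by elim/big_rec2: _ => // i x y _ <-; rewrite ImD. Qed.

Lemma conjc_sum (I : Type) (r : seq I) (p : pred I) (F : I -> C) :
  ((\sum_(i <- r | p i) F i)^*)%C = \sum_(i <- r | p i) ((F i)^*)%C.
Proof. exact: rmorph_sum. Qed.

(** The free weight [e] lets a small residual [w] be split off at the price of a factor close to 1
    on the main term [z]. *)
Lemma csqD_Young (z w : C) (e : R) : 0 < e ->
  csq (z + w) <= (1 + e) * csq z + (1 + e^-1) * csq w.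
Proof.
move=> e0; case: z => a b; case: w => c f; rewrite /csq /=.
have ee : e * e^-1 = 1 by rewrite mulfV ?gt_eqF.
have ei : 0 < e^-1 by rewrite invr_gt0.
have H x y : 2 * (x * y) <= e * x ^+ 2 + e^-1 * y ^+ 2.
  rewrite -subr_ge0.
  have -> : e * x ^+ 2 + e^-1 * y ^+ 2 - 2 * (x * y) = e^-1 * (e * x - y) ^+ 2.
    by rewrite sqrrB; field; rewrite gt_eqF.
  by rewrite mulr_ge0 ?sqr_ge0 // ltW.
have := H a c; have := H b f; nra.
Qed.

(** Cauchy-Schwarz. With S the sum on the left, [key] sums the inequalities |t conj(F_i) - x_i
    conj(S)|^2 >= 0; the best t is |S|^2 / B. *)
Lemma csq_sum_le (I : finType) (F : I -> C) (x : I -> C) :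
  csq (\sum_i x i * F i) <= (\sum_i csq (x i)) * (\sum_i csq (F i)).
Proof.
set A := \sum_i csq (x i); set B := \sum_i csq (F i).
set S := \sum_i _.
have A0 : 0 <= A by apply: sumr_ge0 => i _; exact: csq_ge0.
have B0 : 0 <= B by apply: sumr_ge0 => i _; exact: csq_ge0.
have key (t : R) : 2 * t * csq S <= A * csq S + t ^+ 2 * B.
  have -> : 2 * t * csq S = \sum_i 2 * t * Re (x i * F i * (S^*)%C).
    by rewrite -mulr_sumr -Re_sum -mulr_suml csqE.
  rewrite /A /B mulr_suml mulr_sumr -big_split /=; apply: ler_sum => i _.
  rewrite -(csqJ S); move: (S^*)%C (x i) (F i) => [p q] [a b] [c e]; rewrite /csq /=.
  have := sqr_ge0 (t * c - (a * p - b * q)); have := sqr_ge0 (t * e + (a * q + b * p)); nra.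
have [B1|Bn] := eqVneq B 0.
  (* Here 2 t = A + 2 exceeds A, which forces |S|^2 <= 0. *)
  have := key (A / 2 + 1); rewrite B1 mulr0 addr0 mulr0.
  have := csq_ge0 S; nra.
have := key (csq S / B).
have -> : (csq S / B) ^+ 2 * B = csq S ^+ 2 / B by field.
have -> : 2 * (csq S / B) * csq S = 2 * (csq S ^+ 2 / B) by field.
move=> h. have {}h : csq S ^+ 2 / B <= A * csq S by lra.
have Bp : 0 < B by rewrite lt_def Bn.
move: h; rewrite ler_pdivrMr //; have := csq_ge0 S; rewrite le_eqVlt => /orP[/eqP <- _|Sp].
  by rewrite mulr_ge0.
by rewrite expr2 mulrAC ler_pM2r.
Qed.

End ComplexSquares.

(** * The optimal receive filter, and bounds valid for every channel matrix *)

Section QuadForm.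
Variable R : realType.
Local Notation C := R[i].
Local Notation Re := complex.Re.
Local Notation Im := complex.Im.
Variables (s v : R) (N L : nat).
Hypotheses (s0 : 0 < s) (v0 : 0 < v).
Implicit Types (H : 'M[C]_(N, L)) (a : 'cV[C]_L) (x y : 'cV[C]_N).

Definition beam H y (l : 'I_L) : C := \sum_n ((y n 0)^*)%C * H n l.

Lemma beamE H y l : (ctr y *m H) 0 l = beam H y l.
Proof. by rewrite !mxE; apply: eq_bigr => n _; rewrite !mxE. Qed.

Lemma beamJ H x l : (ctr H *m x) l 0 = ((beam H x l)^*)%C.
Proof.
rewrite !mxE /beam conjc_sum; apply: eq_bigr => n _.
by rewrite !mxE rmorphM /= conjcK mulrC.
Qed.

Lemma Rmat_form H a x y : (ctr y *m Rmat s v H a *m x) 0 0 =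
  (s%:C)%C * (\sum_l ((csq (a l 0))%:C)%C * (beam H y l * ((beam H x l)^*)%C))
  + (v%:C)%C * \sum_n ((y n 0)^*)%C * x n 0.
Proof.
rewrite /Rmat mulmxDr mulmxDl -scalemxAr -scalemxAl mul_mx_scalar -scalemxAl.
rewrite mxE [X in X + _]mxE [X in _ + X]mxE; congr (_ * _ + _ * _); last by
  rewrite mxE; apply: eq_bigr => n _; rewrite !mxE.
rewrite !mulmxA -(mulmxA _ (ctr H)) mxE; apply: eq_bigr => l _.
rewrite beamJ /DDH mul_mx_diag !mxE csqE mulrCA mulrA; congr (_ * _).
by rewrite -beamE mxE mulrC.
Qed.

Lemma ctrK m n (A : 'M[C]_(m, n)) : ctr (ctr A) = A.
Proof. by apply/matrixP => i j; rewrite !mxE conjcK. Qed.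

Lemma ctrM m n p (A : 'M[C]_(m, n)) (B : 'M[C]_(n, p)) :
  ctr (A *m B) = ctr B *m ctr A.
Proof.
apply/matrixP => i j; rewrite !mxE conjc_sum; apply: eq_bigr => k _.
by rewrite !mxE rmorphM mulrC.
Qed.

Lemma sqnormc_ge0 n (y : 'cV[C]_n) : 0 <= sqnormc y.
Proof. by apply: sumr_ge0 => i _; exact: csq_ge0. Qed.

(** Positive definiteness: for a row u of the left kernel, taking x = y = u^H in [Rmat_form] writes
    0 as a nonnegative term plus v |u|^2. *)
Lemma Rmat_unit H a : Rmat s v H a \in unitmx.
Proof.
rewrite -row_free_unit -kermx_eq0; apply/eqP/row_matrixP => i; rewrite row0.
set u := row i _.
have uR : u *m Rmat s v H a = 0 by rewrite /u -row_mul mulmx_ker row0.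
have := Rmat_form H a (ctr u) (ctr u); rewrite ctrK uR mul0mx mxE.
move=> /(congr1 (fun z => Re z)).
set S1 := \sum_l _; set S2 := \sum_n _.
have e1 : S1 = ((\sum_l csq (a l 0) * csq (beam H (ctr u) l))%:C)%C.
  rewrite rmorph_sum /=; apply: eq_bigr => l _.
  by rewrite csqE -rmorphM.
have e2 : S2 = ((\sum_n csq (u 0 n))%:C)%C.
  by rewrite rmorph_sum /=; apply: eq_bigr => l _; rewrite -csqE !mxE conjcK.
rewrite e1 e2 -!rmorphM -rmorphD /= => /esym h.
have h1 : 0 <= \sum_l csq (a l 0) * csq (beam H (ctr u) l).
  by apply: sumr_ge0 => l _; rewrite mulr_ge0 ?csq_ge0.
have h2 : 0 <= \sum_n csq (u 0 n).
  by apply: sumr_ge0 => l _; rewrite csq_ge0.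
have h3 : \sum_n csq (u 0 n) = 0.
  have hs := mulr_ge0 (ltW s0) h1; have hv := mulr_ge0 (ltW v0) h2.
  have : v * \sum_n csq (u 0 n) = 0 by lra.
  by move/eqP; rewrite mulf_eq0 gt_eqF //= => /eqP.
apply/matrixP => k j; rewrite ord1 [RHS]mxE; apply: csq0.
by have /psumr_eq0P := h3; apply => // n _; exact: csq_ge0.
Qed.

(* The witness is [x = R(a)^-1 H a]. *)
Lemma quadform_filter H a : exists x,
  (forall y, (s%:C)%C * (\sum_l ((csq (a l 0))%:C)%C * (beam H y l * ((beam H x l)^*)%C))
     + (v%:C)%C * (\sum_n ((y n 0)^*)%C * x n 0) = \sum_l beam H y l * a l 0)
  /\ quadform s v H a = Re (\sum_l beam H x l * a l 0).
Proof.
exists (invmx (Rmat s v H a) *m (H *m a)); split=> [y|].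
  rewrite -Rmat_form -mulmxA mulKVmx ?Rmat_unit // mulmxA mxE.
  by apply: eq_bigr => l _; rewrite beamE.
rewrite /quadform; set x := invmx _ *m _.
have -> : ctr a *m ctr H *m invmx (Rmat s v H a) *m H *m a = ctr (ctr x *m (H *m a)).
  by rewrite ctrM ctrK ctrM /x !mulmxA.
rewrite mulmxA !mxE; set S := \sum_l _.
have -> : S = \sum_l beam H x l * a l 0.
  by apply: eq_bigr => l _; rewrite beamE.
by case: (\sum_l _).
Qed.

(* Concave in [y], with maximum [quadform]: this removes the matrix inverse,
   leaving a polynomial in [H], [a] and [y]. *)
Definition qform H a y : R :=
  2 * Re (\sum_l beam H y l * a l 0)
  - s * (\sum_l csq (a l 0) * csq (beam H y l)) - v * sqnormc y.

Lemma quadform_max H a : exists x,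
  [/\ quadform s v H a = s * (\sum_l csq (a l 0) * csq (beam H x l)) + v * sqnormc x,
      quadform s v H a = Re (\sum_l beam H x l * a l 0) &
      forall y, qform H a y <= quadform s v H a].
Proof.
have [x [xE qE]] := quadform_filter H a; exists x.
have q2 : quadform s v H a = s * (\sum_l csq (a l 0) * csq (beam H x l)) + v * sqnormc x.
  rewrite qE -xE; set S1 := \sum_l _; set S2 := \sum_n _.
  have -> : S1 = ((\sum_l csq (a l 0) * csq (beam H x l))%:C)%C.
    rewrite rmorph_sum /=; apply: eq_bigr => l _.
    by rewrite csqE -rmorphM.
  have -> : S2 = ((sqnormc x)%:C)%C.
    rewrite rmorph_sum /=; apply: eq_bigr => n _.
    by rewrite -/(csq _) -csqE mulrC.
  by rewrite -!rmorphM -rmorphD.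
split=> // y; rewrite /qform -xE q2 ReD.
have ReZ (r : R) z : Re ((r%:C)%C * z) = r * Re z by case: z => p q /=; ring.
rewrite !ReZ !Re_sum.
have h1 : 2 * (\sum_l Re (((csq (a l 0))%:C)%C * (beam H y l * ((beam H x l)^*)%C)))
   <= (\sum_l csq (a l 0) * csq (beam H x l)) + \sum_l csq (a l 0) * csq (beam H y l).
  rewrite mulr_sumr -big_split /=; apply: ler_sum => l _; rewrite ReZ.
  rewrite -mulrDr mulrCA ler_wpM2l ?csq_ge0 //.
  case: (beam H y l) (beam H x l) => [p q] [p' q']; rewrite /csq /=.
  have := sqr_ge0 (p - p'); have := sqr_ge0 (q - q'); nra.
have h2 : 2 * (\sum_n Re (((y n 0)^*)%C * x n 0)) <= sqnormc x + sqnormc y.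
  rewrite mulr_sumr -big_split /=; apply: ler_sum => l _.
  case: (y l 0) (x l 0) => [p q] [p' q']; rewrite /=.
  have := sqr_ge0 (p - p'); have := sqr_ge0 (q - q'); nra.
have := ler_wpM2l (ltW s0) h1; have := ler_wpM2l (ltW v0) h2; lra.
Qed.

Lemma quadform_ge0 H a : 0 <= quadform s v H a.
Proof.
have [x [-> _ _]] := quadform_max H a.
rewrite addr_ge0 ?(mulr_ge0 (ltW v0)) ?sqnormc_ge0 // (mulr_ge0 (ltW s0)) //.
apply: sumr_ge0 => l _; exact: mulr_ge0 (csq_ge0 _) (csq_ge0 _).
Qed.

Lemma csq_beam_le H y l : csq (beam H y l) <= sqnormc y * \sum_n csq (H n l).
Proof.
apply: le_trans (csq_sum_le _ _) _; apply: ler_wpM2r.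
  by apply: sumr_ge0 => n _; exact: csq_ge0.
by apply: ler_sum => n _; rewrite csqJ.
Qed.

Lemma quadform_le_sensors H a (Pw : R) : 0 < Pw -> sqnormc a <= Pw ->
  quadform s v H a <= \sum_l (\sum_n csq (H n l)) / (s * (\sum_n csq (H n l)) + v / Pw).
Proof.
move=> P0 aP; have [x [q2 q3 _]] := quadform_max H a.
set c := v / Pw; have c0 : 0 < c by rewrite divr_gt0.
set t := fun l : 'I_L => \sum_n csq (H n l).
have t0 l : 0 <= t l by apply: sumr_ge0 => n _; exact: csq_ge0.
(* The copy of the objective on the right absorbs the quadratic terms that AM-GM produces. *)
suff h : 2 * quadform s v H a <= quadform s v H a + \sum_l t l / (s * t l + c) by lra.
(* As |a|^2 <= Pw, the noise term v |x|^2 is at least c |x|^2 |a|^2, which splits over the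
   sensors. *)
have q4 : \sum_l csq (a l 0) * (s * csq (beam H x l) + c * sqnormc x) <= quadform s v H a.
  have -> : \sum_l csq (a l 0) * (s * csq (beam H x l) + c * sqnormc x) =
     s * (\sum_l csq (a l 0) * csq (beam H x l)) + c * sqnormc x * sqnormc a.
    rewrite !mulr_sumr -big_split /=; apply: eq_bigr => l _; rewrite -/(csq _); ring.
  rewrite q2 lerD2l mulrAC ler_wpM2r ?sqnormc_ge0 //.
  by rewrite /c mulrAC ler_pdivrMr // ler_wpM2l // ltW.
apply: le_trans (lerD q4 (lexx _)).
rewrite q3 Re_sum mulr_sumr -big_split /=; apply: ler_sum => l _.
have := Re_le_cabs (beam H x l * a l 0); rewrite cabsM.
have := csq_beam_le H x l; rewrite -/(t l) -!cabs_sqr.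
have := cabs_ge0 (a l 0); have := cabs_ge0 (beam H x l).
have := sqnormc_ge0 x; have := t0 l.
move: (cabs (a l 0)) (cabs (beam _ _ _)) (sqnormc x) (t l) (Re _) => A b X u r u0 X0 b0 A0 hb hr.
suff: 2 * (A * b) <= A ^+ 2 * (s * b ^+ 2 + c * X) + u / (s * u + c) by lra.
have D0 : 0 < s * u + c by rewrite ltr_wpDl // mulr_ge0 // ltW.
(* Here A = |a_l|, b = |x^H h_l|, X = |x|^2 and u = |h_l|^2. AM-GM gives 2 A b <= A^2 E + b^2 / E,
   and b^2 <= X u bounds b^2 / E by u / (s u + c). The case b = 0 is separate because E may vanish
   there. *)
have [->|bn] := eqVneq b 0.
  rewrite mulr0 mulr0 addr_ge0 //; last by rewrite divr_ge0 // ltW.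
  by rewrite mulr_ge0 ?sqr_ge0 // expr0n /= mulr0 add0r mulr_ge0 // ltW.
have bp : 0 < b ^+ 2 by rewrite exprn_gt0 // lt_def bn.
set E := s * b ^+ 2 + c * X.
have E0 : 0 < E by apply: ltr_wpDr; [exact: mulr_ge0 (ltW c0) X0 | exact: mulr_gt0].
have : b ^+ 2 / E <= u / (s * u + c).
  rewrite ler_pdivrMr // mulrAC ler_pdivlMr // /E.
  have : b ^+ 2 * c <= X * u * c by rewrite ler_wpM2r // ltW.
  move=> h; nra.
have -> : 2 * (A * b) = A ^+ 2 * E + b ^+ 2 / E - (A * E - b) ^+ 2 / E.
  by field; rewrite gt_eqF.
have : 0 <= (A * E - b) ^+ 2 / E by rewrite divr_ge0 ?sqr_ge0 // ltW.
lra.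
Qed.

(** The sensor noise is dropped, keeping only v |x|^2 <= q. AM-GM with weights Lam / v and v / Lam
    bounds 2 q by (Lam / v) |a|^2 + v |x|^2, and the last term is absorbed by q. [Lam] plays the
    role of the largest eigenvalue of H H^H. *)
Lemma quadform_le_gram H a (Pw Lam : R) : 0 < Pw -> 0 < Lam -> sqnormc a <= Pw ->
  (forall y, \sum_l csq (beam H y l) <= Lam * sqnormc y) ->
  quadform s v H a <= Pw / v * Lam.
Proof.
move=> P0 L0 aP hL; have [x [q2 q3 _]] := quadform_max H a.
have h1 : v * sqnormc x <= quadform s v H a.
  rewrite q2 lerDr (mulr_ge0 (ltW s0)) //.
  apply: sumr_ge0 => l _; exact: mulr_ge0 (csq_ge0 _) (csq_ge0 _).
suff h : 2 * quadform s v H a <= Lam / v * sqnormc a + v / Lam * \sum_l csq (beam H x l).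
  have h2 : v / Lam * \sum_l csq (beam H x l) <= v * sqnormc x.
    by rewrite mulrAC ler_pdivrMr // -mulrA ler_wpM2l ?(ltW v0) // mulrC.
  have h3 : Lam / v * sqnormc a <= Lam / v * Pw by rewrite ler_wpM2l // divr_ge0 // ltW.
  have -> : Pw / v * Lam = Lam / v * Pw by ring.
  lra.
rewrite q3 Re_sum !mulr_sumr -big_split /=; apply: ler_sum => l _.
have := Re_le_cabs (beam H x l * a l 0); rewrite cabsM -!/(csq _) -!cabs_sqr.
move: (cabs _) (cabs _) (Re _) => A b r hr.
have : 0 <= (Lam * A - v * b) ^+ 2 / (Lam * v) by rewrite divr_ge0 ?sqr_ge0 // mulr_ge0 ?ltW.
have -> : (Lam * A - v * b) ^+ 2 / (Lam * v) = Lam / v * A ^+ 2 + v / Lam * b ^+ 2 - 2 * (b * A).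
  by field; rewrite !gt_eqF.
lra.
Qed.

End QuadForm.

(** * One antenna, and measurability of the optimal value *)

Section OneAntenna.
Variable R : realType.
Local Notation C := R[i].
Local Notation Re := complex.Re.

Lemma sqnormcZ n (t : R) (a : 'cV[C]_n) : sqnormc ((t%:C)%C *: a) = t ^+ 2 * sqnormc a.
Proof.
rewrite /sqnormc mulr_sumr; apply: eq_bigr => l _; rewrite -!/(csq _) mxE; exact: csqZ.
Qed.

Lemma beamZ (N L : nat) (H : 'M[C]_(N, L)) (t : R) y l :
  beam H ((t%:C)%C *: y) l = (t%:C)%C * beam H y l.
Proof.
rewrite /beam mulr_sumr; apply: eq_bigr => n _; rewrite mxE rmorphM /= oppr0.
by rewrite mulrA.
Qed.

(* The maximiser is proportional to conj(h_l) / (s |h_l|^2 + v / Pw). *)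
Lemma quadform_opt1_ge (s v Pw : R) (L : nat) (H : 'M[C]_(1, L)) a :
  0 < s -> 0 < v -> 0 < Pw -> is_opt_gain s v Pw H a ->
  \sum_l csq (H 0 l) / (s * csq (H 0 l) + v / Pw) <= quadform s v H a.
Proof.
move=> s0 v0 P0 [_ aopt]; set c := v / Pw; set S := \sum_l _.
have c0 : 0 < c by rewrite divr_gt0.
pose D l := s * csq (H 0 l) + c.
have D0 l : 0 < D l by rewrite ltr_wpDl // mulr_ge0 ?csq_ge0 // ltW.
pose g : 'cV[C]_L := \col_l (((D l)^-1)%:C%C * ((H 0 l)^*)%C).
have gE l : csq (g l 0) = csq (H 0 l) / D l ^+ 2.
  by rewrite mxE csqZ csqJ exprVn mulrC.
pose G := sqnormc g.
have GE : G = \sum_l csq (g l 0) by [].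
have SE : s * (\sum_l csq (g l 0) * csq (H 0 l)) + c * G = S.
  rewrite GE !mulr_sumr -big_split /=; apply: eq_bigr => l _.
  rewrite gE -/(D l) /D; field; exact: lt0r_neq0 (D0 l).
(* If G = 0 then [g] cannot be scaled to power Pw; but all channel coefficients are then 0, and so
   is S. *)
have [G1|Gn] := eqVneq G 0.
  have -> : S = 0; last exact: quadform_ge0.
  rewrite /S big1 // => l _.
  have /psumr_eq0P : \sum_l csq (g l 0) = 0 by rewrite -GE.
  move=> /(_ (fun i _ => csq_ge0 _) l isT); rewrite gE.
  move/eqP; rewrite mulf_eq0 => /orP[/eqP->|]; first by rewrite mul0r.
  by rewrite invr_eq0 expf_eq0 /= gt_eqF.
have G0 : 0 < G by rewrite lt_def Gn sqnormc_ge0.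
pose k := Num.sqrt (Pw / G).
have k2 : k ^+ 2 = Pw / G by rewrite sqr_sqrtr // divr_ge0 // ltW.
have k0 : 0 < k by rewrite sqrtr_gt0 divr_gt0.
pose b : 'cV[C]_L := (k%:C)%C *: g.
have bP : sqnormc b <= Pw by rewrite sqnormcZ k2 divfK.
apply: le_trans (aopt b bP).
(* The scalar filter 1 / k undoes the scaling of the gains: the signal term is S, the sensor-noise
   term is that of [g], and v / k^2 = c G. By [SE] the value of [qform] is 2 S - S = S. *)
have [_ [_ _ /(_ (((k^-1)%:C)%C *: (1%:M)))]] := quadform_max s0 v0 H b.
apply: le_trans; rewrite /qform sqnormcZ.
have bE l : beam H (1%:M : 'cV_1) l = H 0 l.
  by rewrite /beam big_ord1 mxE eqxx mulr1n conjc1 mul1r.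
under eq_bigr => l _ do rewrite beamZ bE.
have -> : sqnormc (1%:M : 'cV[C]_1) = 1.
  by rewrite /sqnormc big_ord1 mxE /= expr0n expr1n addr0.
have -> : Re (\sum_(l < L) (k^-1)%:C%C * H 0 l * b l 0) = S.
  rewrite Re_sum; apply: eq_bigr => l _.
  have -> : (k^-1)%:C%C * H 0 l * b l 0 = ((k^-1 * k * (D l)^-1)%:C)%C * (H 0 l * ((H 0 l)^*)%C).
    by rewrite !mxE !rmorphM /=; ring.
  by rewrite csqE mulVf ?gt_eqF // mul1r -rmorphM /= mulrC.
have -> : \sum_(l < L) csq (b l 0) * csq (beam H ((k^-1)%:C%C *: 1%:M) l)
   = \sum_l csq (g l 0) * csq (H 0 l).
  apply: eq_bigr => l _; rewrite beamZ bE csqZ mxE csqZ exprVn; field.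
  by rewrite gt_eqF.
have -> : v * (k^-1 ^+ 2 * 1) = c * G.
  by rewrite exprVn k2 /c invf_div mulr1; field; rewrite !gt_eqF.
by rewrite -SE; lra.
Qed.

End OneAntenna.

(** * Function classes closed under ring operations, for use with both continuity and
    measurability *)

Section Closure.
Variables (R : realType) (D : Type) (S : (D -> R) -> Prop).
Local Notation C := R[i].
Hypotheses (Scst : forall c, S (fun _ => c))
  (SD : forall f g, S f -> S g -> S (fun x => f x + g x))
  (SM : forall f g, S f -> S g -> S (fun x => f x * g x))
  (SN : forall f, S f -> S (fun x => - f x)).

Definition complex_in (f : D -> C) :=
  S (fun x => complex.Re (f x)) /\ S (fun x => complex.Im (f x)).

Lemma closed_sum (I : Type) (r : seq I) (F : I -> D -> R) :
  (forall i, S (F i)) -> S (fun x => \sum_(i <- r) F i x).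
Proof.
move=> SF; elim: r => [|i r IH].
  by under eq_fun do rewrite big_nil.
by under eq_fun do rewrite big_cons; exact: SD.
Qed.

Lemma complex_inM f g : complex_in f -> complex_in g ->
  complex_in (fun x => f x * g x).
Proof.
have ReM (z w : C) : complex.Re (z * w) =
    complex.Re z * complex.Re w + - (complex.Im z * complex.Im w) by case: z; case: w.
have ImM (z w : C) : complex.Im (z * w) =
    complex.Re z * complex.Im w + complex.Im z * complex.Re w by case: z; case: w.
move=> [f1 f2] [g1 g2]; split.
  by under eq_fun do rewrite ReM; apply: SD; [exact: SM|exact/SN/SM].
by under eq_fun do rewrite ImM; apply: SD; exact: SM.
Qed.

Lemma complex_inJ f : complex_in f -> complex_in (fun x => ((f x)^*)%C).
Proof.
have ReJ (z : C) : complex.Re ((z^*)%C) = complex.Re z by case: z.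
have ImJ (z : C) : complex.Im ((z^*)%C) = - complex.Im z by case: z.
move=> [f1 f2]; split; first by under eq_fun do rewrite ReJ.
by under eq_fun do rewrite ImJ; exact: SN.
Qed.

Lemma complex_in_sum (I : Type) (r : seq I) (F : I -> D -> C) :
  (forall i, complex_in (F i)) -> complex_in (fun x => \sum_(i <- r) F i x).
Proof.
move=> SF; split.
  by under eq_fun do rewrite Re_sum; apply: closed_sum => i; case: (SF i).
by under eq_fun do rewrite Im_sum; apply: closed_sum => i; case: (SF i).
Qed.

Lemma closed_csq f : complex_in f -> S (fun x => csq (f x)).
Proof. by move=> [f1 f2]; apply: SD; exact: SM. Qed.

(** [qform] is a real polynomial in the real and imaginary parts of its arguments. This serves for
    continuity in the gains and the filter at a fixed channel, and for measurability in the channel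
    at fixed gains and filter. *)
Lemma closed_qform (s v : R) (N L : nat) (H : D -> 'M[C]_(N, L)) (a : D -> 'cV[C]_L)
    (y : D -> 'cV[C]_N) :
  (forall n l, complex_in (fun x => H x n l)) ->
  (forall l, complex_in (fun x => a x l 0)) ->
  (forall n, complex_in (fun x => y x n 0)) ->
  S (fun x => qform s v (H x) (a x) (y x)).
Proof.
move=> SH Sa Sy.
have Sb l : complex_in (fun x => beam (H x) (y x) l).
  by apply: complex_in_sum => n; apply: complex_inM => //; exact: complex_inJ.
apply: SD; [apply: SD|].
- apply: SM => //.
  by apply: (proj1 (@complex_in_sum _ _ (fun l x => beam (H x) (y x) l * a x l 0) _)) => l;
    exact: complex_inM.
- by apply/SN/SM => //; apply: closed_sum => l; apply: SM; exact: closed_csq.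
- by apply/SN/SM => //; apply: closed_sum => l; exact: closed_csq.
Qed.

End Closure.

Section Sup.
Variable R : realType.

Lemma open_mx_rat (m n : nat) (U : set 'M[R]_(m, n)) :
  open U -> U !=set0 -> exists q : 'M[rat]_(m, n), U (map_mx ratr q).
Proof.
rewrite openE => oU [M UM]; have /nbhs_ballP[e e0 eU] := oU _ UM.
have /choice[q qP] : forall ij : 'I_m * 'I_n, exists q : rat,
    `|M ij.1 ij.2 - ratr q| < e.
  move=> ij; have : M ij.1 ij.2 - e < M ij.1 ij.2 + e by rewrite /= in e0; lra.
  by move=> /rat_in_itvoo[q]; rewrite in_itv /= => qP; exists q; rewrite distrC ltr_distl.
exists (\matrix_(i, j) q (i, j)); apply: eU; split=> // i j.
by rewrite !mxE; exact: (qP (i, j)).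
Qed.

(** The last hypothesis says that [V] is the pointwise supremum of [F] over [U]. For fixed w the
    points of [U] with F p w > a form an open set, which contains a rational matrix as soon as it is
    nonempty; hence {V > a} is a countable union of measurable sets. *)
Lemma measurable_sup (d : measure_display) (T : measurableType d) (m n : nat)
    (U : set 'M[R]_(m, n)) (F : 'M[R]_(m, n) -> T -> R) (V : T -> R) :
  open U -> (forall w, continuous (F^~ w)) -> (forall p, measurable_fun setT (F p)) ->
  (forall w a, (a < V w) <-> (exists2 p, U p & a < F p w)) ->
  measurable_fun setT V.
Proof.
move=> oU cF mF VF; apply: (measurability _ (RGenOInfty.measurableE R)).
move=> _ [_ [a ->] <-]; rewrite setTI.
have -> : V @^-1` `]a, +oo[ = \bigcup_(q : 'M[rat]_(m, n))
    [set w | U (map_mx ratr q) /\ a < F (map_mx ratr q) w].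
  apply/seteqP; split=> w /=.
    rewrite in_itv /= andbT => /VF[p Up ap].
    have [||q [/= q1 q2]] := @open_mx_rat _ _ (U `&` (F^~ w @^-1` [set x | a < x])).
    - apply: openI => //; apply: open_comp; last exact: open_gt.
      by move=> x _; exact: cF.
    - by exists p.
    - by exists q.
  by move=> [q _ [q1 q2]]; rewrite in_itv /= andbT; apply/VF; exists (map_mx ratr q).
apply: countable_bigcupT_measurable; first exact: countableP.
move=> q; have [h|h] := pselect (U (map_mx ratr q)).
  rewrite (_ : [set _ | _] = F (map_mx ratr q) @^-1` `]a, +oo[).
    by rewrite -[X in measurable X]setTI; apply: mF => //; exact: measurable_itv.
  by apply/seteqP; split=> w /=; rewrite in_itv /= andbT; tauto.
by rewrite (_ : [set _ | _] = set0) //; apply/seteqP; split=> w //= -[].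
Qed.

End Sup.

Section OptMeasurable.
Variables (R : realType) (s v Pw : R) (N L : nat).
Local Notation C := R[i].
Hypotheses (s0 : 0 < s) (v0 : 0 < v) (P0 : 0 < Pw).

(* The real matrix [p] encodes a filter in C^N and a gain vector in C^L. *)
Definition pfilter (p : 'M[R]_(2, N + L)) : 'cV[C]_N :=
  \col_n (p 0 (lshift L n) +i* p 1 (lshift L n))%C.
Definition pgain (p : 'M[R]_(2, N + L)) : 'cV[C]_L :=
  \col_l (p 0 (rshift N l) +i* p 1 (rshift N l))%C.

Lemma pencode (y : 'cV[C]_N) (a : 'cV[C]_L) :
  exists p, pfilter p = y /\ pgain p = a.
Proof.
pose p : 'M[R]_(2, N + L) := \matrix_(i, j)
  if i == 0 then complex.Re (col_mx y a j 0) else complex.Im (col_mx y a j 0).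
have pE i j : p i j = if i == 0 then complex.Re (col_mx y a j 0)
                      else complex.Im (col_mx y a j 0) by rewrite mxE.
exists p; split; apply/matrixP => i j; rewrite ord1 mxE !pE /=.
  by rewrite col_mxEu; case: (y i 0).
by rewrite col_mxEd; case: (a i 0).
Qed.

(** The strict power constraint makes the parameter set open, but may exclude the optimal gain
    itself. Shrinking that gain by 1 - e with the filter x kept costs at most 2 e q, and e is chosen
    so that this stays below q - r. *)
Lemma opt_gt (H : 'M[C]_(N, L)) a r : is_opt_gain s v Pw H a ->
  (r < quadform s v H a) <->
  exists2 p, sqnormc (pgain p) < Pw & r < qform s v H (pgain p) (pfilter p).
Proof.
move=> [aP aopt]; split; last first.
  move=> [p pP /lt_le_trans]; apply; apply: le_trans (aopt _ (ltW pP)).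
  by have [x [_ _]] := quadform_max s0 v0 H (pgain p); apply.
have [x [q2 q3 _]] := quadform_max s0 v0 H a.
set q := quadform _ _ _ _ in q2 q3 *; move=> rq.
have q0 : 0 <= q by exact: quadform_ge0.
pose e := Num.min 1 ((q - r) / (4 * (q + 1))).
have den : 0 < 4 * (q + 1) by lra.
have e0 : 0 < e by rewrite lt_min ltr01 divr_gt0 // subr_gt0.
have e1 : e <= 1 by rewrite ge_min lexx.
have e2 : e * (4 * (q + 1)) <= q - r.
  by rewrite -ler_pdivlMr // ge_min lexx orbT.
have [p [pf pg]] := pencode x (((1 - e)%:C)%C *: a).
exists p; rewrite pg ?pf.
  rewrite sqnormcZ; apply: le_lt_trans (_ : (1 - e) ^+ 2 * Pw < _).
    by rewrite ler_wpM2l ?sqr_ge0.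
  by rewrite gtr_pMl //; nra.
rewrite /qform.
have -> : \sum_l beam H x l * ((1 - e)%:C%C *: a) l 0 =
   ((1 - e)%:C)%C * \sum_l beam H x l * a l 0.
  by rewrite mulr_sumr; apply: eq_bigr => l _; rewrite mxE mulrCA.
have -> : complex.Re ((1 - e)%:C%C * (\sum_l beam H x l * a l 0)) = (1 - e) * q.
  by rewrite q3; case: (\sum_l _) => c c' /=; rewrite mul0r subr0.
have -> : \sum_l csq (((1 - e)%:C%C *: a) l 0) * csq (beam H x l) =
   (1 - e) ^+ 2 * \sum_l csq (a l 0) * csq (beam H x l).
  rewrite mulr_sumr; apply: eq_bigr => l _; rewrite mxE csqZ; exact: esym (mulrA _ _ _).
have : 0 <= \sum_l csq (a l 0) * csq (beam H x l).
  by apply: sumr_ge0 => l _; exact: mulr_ge0 (csq_ge0 _) (csq_ge0 _).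
move: q2; set B := \sum_l _; move=> q2 B0.
have sB : 0 <= s * B by rewrite mulr_ge0 // ltW.
have : (1 - e) ^+ 2 * (s * B) <= s * B.
  by rewrite ler_piMl //; nra.
nra.
Qed.

(* A measure takes junk values on non-measurable sets, and the optimal gains are
   arbitrary functions on [T]; but the optimal value, a supremum of polynomials
   over a separable set, is measurable. *)
Lemma opt_measurable (d : measure_display) (T : measurableType d)
    (H : T -> 'M[C]_(N, L)) (a : T -> 'cV[C]_L) :
  (forall n l, cmeasurable (fun w => H w n l)) ->
  (forall w, is_opt_gain s v Pw (H w) (a w)) ->
  measurable_fun setT (fun w => quadform s v (H w) (a w)).
Proof.
move=> mH aopt.
pose Scont (f : 'M[R]_(2, N + L) -> R) := continuous f.
have cstc (c : R) : Scont (fun _ => c) by exact: cst_continuous.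
have Dc f g : Scont f -> Scont g -> Scont (fun p => f p + g p).
  by move=> cf cg p; exact: (cvgD (cf p) (cg p)).
have Mc f g : Scont f -> Scont g -> Scont (fun p => f p * g p).
  by move=> cf cg p; exact: (cvgM (cf p) (cg p)).
have Nc f : Scont f -> Scont (fun p => - f p).
  by move=> cf p; exact: (cvgN (cf p)).
have cg l : complex_in Scont (fun p => pgain p l 0).
  by split; under eq_fun do rewrite mxE /=; exact: coord_continuous.
have cf n : complex_in Scont (fun p => pfilter p n 0).
  by split; under eq_fun do rewrite mxE /=; exact: coord_continuous.
apply: (@measurable_sup _ _ _ 2 (N + L) [set p | sqnormc (pgain p) < Pw]
   (fun p w => qform s v (H w) (pgain p) (pfilter p))).
- rewrite (_ : [set _ | _] = (fun p => sqnormc (pgain p)) @^-1` [set x | x < Pw]) //.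
  apply: open_comp; last exact: open_lt.
  move=> p _; move: p; apply: (@closed_sum _ _ Scont) => // l.
  exact: (@closed_csq _ _ Scont).
- move=> w; apply: (@closed_qform _ _ Scont) => //.
- move=> p; apply: (@closed_qform _ _ (fun f : T -> R => measurable_fun setT f)) => //.
  + by move=> *; exact: measurable_funD.
  + by move=> *; exact: measurable_funM.
  + by move=> *; exact: measurableT_comp.
- by move=> w r; exact: opt_gt.
Qed.

End OptMeasurable.

(** * Expectations and limits in probability *)

Section Expectation.
Context (R : realType) (d : measure_display) (T : measurableType d) (P : probability T R).
Implicit Types f g : T -> R.

Definition intg f := P.-integrable setT (EFin \o f).
Definition Ex f : R := \int[P]_w f w.

(** Unlike integrability, this is stable under products, so products of independent factors are
    handled in this class. *)
Definition bmf f := measurable_fun setT f /\ exists M, forall w, `|f w| <= M.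

Lemma bmf_intg f : bmf f -> intg f.
Proof.
move=> [mf [M fM]]; apply: measurable_bounded_integrable => //.
  by apply: le_lt_trans (probability_le1 P measurableT) _; rewrite ltry.
exists M; split; first exact: num_real.
by move=> x Mx w _; exact: le_trans (fM w) (ltW Mx).
Qed.

Lemma bmf_cst c : bmf (fun=> c).
Proof. by split=> //; exists `|c|. Qed.

Lemma bmfD f g : bmf f -> bmf g -> bmf (fun w => f w + g w).
Proof.
move=> [mf [M fM]] [mg [M' gM]]; split; first exact: measurable_funD.
by exists (M + M') => w; apply: le_trans (ler_normD _ _) (lerD _ _).
Qed.

Lemma bmfM f g : bmf f -> bmf g -> bmf (fun w => f w * g w).
Proof.
move=> [mf [M fM]] [mg [M' gM]]; split; first exact: measurable_funM.
by exists (M * M') => w; rewrite normrM ler_pM.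
Qed.

Lemma bmfN f : bmf f -> bmf (fun w => - f w).
Proof.
move=> [mf [M fM]]; split; first exact: measurableT_comp.
by exists M => w; rewrite normrN.
Qed.

Lemma bmfB f g : bmf f -> bmf g -> bmf (fun w => f w - g w).
Proof. by move=> bf bg; apply: bmfD => //; exact: bmfN. Qed.

Lemma bmf_sum (I : Type) (s : seq I) (F : I -> T -> R) :
  (forall i, bmf (F i)) -> bmf (fun w => \sum_(i <- s) F i w).
Proof.
move=> bF; elim: s => [|i s IH].
  by under eq_fun do rewrite big_nil; exact: bmf_cst.
by under eq_fun do rewrite big_cons; exact: bmfD.
Qed.

Lemma bmf_prod (I : Type) (s : seq I) (F : I -> T -> R) :
  (forall i, bmf (F i)) -> bmf (fun w => \prod_(i <- s) F i w).
Proof.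
move=> bF; elim: s => [|i s IH].
  by under eq_fun do rewrite big_nil; exact: bmf_cst.
by under eq_fun do rewrite big_cons; exact: bmfM.
Qed.

Lemma intg_cst c : intg (fun=> c).
Proof. exact/bmf_intg/bmf_cst. Qed.

Lemma intgD f g : intg f -> intg g -> intg (fun w => f w + g w).
Proof. by move=> hf hg; exact: (integrableD measurableT hf hg). Qed.

Lemma intgZ c f : intg f -> intg (fun w => c * f w).
Proof. by move=> hf; exact: (integrableZl measurableT c hf). Qed.

Lemma intgN f : intg f -> intg (fun w => - f w).
Proof.
by move=> /(intgZ (-1)); congr intg; apply/funext => w; rewrite mulN1r.
Qed.

Lemma intgB f g : intg f -> intg g -> intg (fun w => f w - g w).
Proof. by move=> hf hg; apply: intgD => //; exact: intgN. Qed.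

Lemma intg_sum (I : Type) (s : seq I) (F : I -> T -> R) :
  (forall i, intg (F i)) -> intg (fun w => \sum_(i <- s) F i w).
Proof.
move=> bF; elim: s => [|i s IH].
  by under eq_fun do rewrite big_nil; exact: intg_cst.
by under eq_fun do rewrite big_cons; exact: intgD.
Qed.

Lemma intg_measurable f : intg f -> measurable_fun setT f.
Proof. by move=> /measurable_int /measurable_EFinP. Qed.

Lemma intg_le f g : measurable_fun setT f -> intg g ->
  (forall w, `|f w| <= g w) -> intg f.
Proof.
move=> mf hg fg; apply: le_integrable hg => //; first exact/measurable_EFinP.
by move=> w _ /=; rewrite lee_fin; exact: le_trans (fg w) (ler_norm _).
Qed.

Lemma intg_abs f : intg f -> intg (fun w => `|f w|).
Proof.
move=> hf; apply: le_integrable (hf) => //.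
  by apply/measurable_EFinP/measurableT_comp => //; exact: intg_measurable.
by move=> w _ /=; rewrite normr_id.
Qed.

Lemma ExD f g : intg f -> intg g -> Ex (fun w => f w + g w) = Ex f + Ex g.
Proof. by move=> hf hg; rewrite /Ex RintegralD. Qed.

Lemma ExZ c f : intg f -> Ex (fun w => c * f w) = c * Ex f.
Proof. by move=> hf; rewrite /Ex RintegralZl. Qed.

Lemma ExN f : intg f -> Ex (fun w => - f w) = - Ex f.
Proof.
move=> hf; rewrite -mulN1r -ExZ //; congr Ex; apply/funext => w.
by rewrite mulN1r.
Qed.

Lemma ExB f g : intg f -> intg g -> Ex (fun w => f w - g w) = Ex f - Ex g.
Proof. by move=> hf hg; rewrite ExD ?ExN //; exact: intgN. Qed.

Lemma Ex_cst c : Ex (fun=> c) = c.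
Proof.
rewrite /Ex Rintegral_cst // [X in fine X](_ : _ = 1%E) ?mulr1 //.
exact: probability_setT.
Qed.

Lemma Ex_sum (I : Type) (s : seq I) (F : I -> T -> R) : (forall i, intg (F i)) ->
  Ex (fun w => \sum_(i <- s) F i w) = \sum_(i <- s) Ex (F i).
Proof.
move=> hF; elim: s => [|i s IH].
  by under eq_fun do rewrite big_nil; rewrite Ex_cst big_nil.
under eq_fun do rewrite big_cons.
by rewrite ExD ?big_cons ?IH //; exact: intg_sum.
Qed.

Lemma Ex_le f g : intg f -> intg g -> (forall w, f w <= g w) -> Ex f <= Ex g.
Proof. by move=> hf hg fg; apply: le_Rintegral. Qed.

Lemma Ex_ge0 f : (forall w, 0 <= f w) -> 0 <= Ex f.
Proof. by move=> f0; apply: Rintegral_ge0. Qed.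

Lemma Ex_abs f : intg f -> `|Ex f| <= Ex (fun w => `|f w|).
Proof. by move=> hf; exact: le_normr_Rintegral. Qed.

Lemma ExE f : intg f -> (\int[P]_w (f w)%:E)%E = (Ex f)%:E.
Proof. by move=> hf; rewrite /Ex /Rintegral fineK // integrable_fin_num. Qed.

Lemma bmf_indic (A : set T) : measurable A -> bmf (\1_A).
Proof.
move=> mA; split; first exact: measurable_indic.
by exists 1 => w; rewrite indicE; case: (_ \in _); rewrite ?normr1 ?normr0.
Qed.

Lemma Ex_indic (A : set T) : measurable A -> Ex (\1_A) = fine (P A).
Proof. by move=> mA; rewrite /Ex /Rintegral integral_indic // setIT. Qed.

Lemma Ex_eq0 f : intg f -> (forall w, 0 <= f w) -> Ex f = 0 ->
  ae_eq P setT (EFin \o f) (cst 0%E).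
Proof.
move=> hf f0 f00; apply/(ae_eq_integral_abs P measurableT) => //.
  exact/measurable_EFinP/intg_measurable.
rewrite (_ : 0%E = (Ex f)%:E); last by rewrite f00.
rewrite -ExE //; apply: eq_integral => w _ /=.
by rewrite ger0_norm.
Qed.

(** * Comparison of a limit in probability with bounds on means *)

Section InProbability.
Variables (X : nat -> T -> R) (c0 : R).
Hypotheses (mX : forall L, measurable_fun setT (X L)) (Xc0 : cvg_in_prob P X c0).

Let A e L := [set w | e <= `|X L w - c0|].

Let mA e L : measurable (A e L).
Proof.
rewrite -[A e L]setTI; apply: measurable_fun_le => //.
apply: measurableT_comp => //; exact: measurable_funB.
Qed.

Let PA e eta : 0 < e -> 0 < eta -> exists L0, forall L, (L0 <= L)%N -> Ex (\1_(A e L)) <= eta.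
Proof.
move=> e0 eta0; have /fine_cvgP[_ /cvgrPdist_lt /(_ eta eta0)[L0 _ L0P]] := Xc0 e0.
exists L0 => L /L0P /=; rewrite Ex_indic // sub0r normrN => h.
exact: le_trans (ler_norm _) (ltW h).
Qed.

(** Let A be the event |X - c0| >= e/2. Off A, Y >= X > c0 - e/2; on A, Y >= 0 is enough. So c0 -
    e/2 <= Y + |c0| 1_A everywhere, and the mean of the last term vanishes as L grows. *)
Lemma in_prob_le (Y : nat -> T -> R) c L0 : (forall L, intg (Y L)) ->
  (forall L w, 0 <= Y L w) -> (forall L w, X L w <= Y L w) ->
  (forall L, (L0 <= L)%N -> Ex (Y L) <= c) -> c0 <= c.
Proof.
move=> iY Y0 XY EY; apply/ler_addgt0Pr => e e0.
have c00 : 0 <= `|c0| by [].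
have den : 0 < 2 * (`|c0| + 1) by lra.
have [L1 L1P] := PA (divr_gt0 e0 (ltr0Sn R 1)) (divr_gt0 e0 den).
set L := maxn L0 L1.
have bA := bmf_intg (bmf_indic (mA (e / 2) L)).
have : c0 - e / 2 <= Ex (fun w => Y L w + `|c0| * \1_(A (e / 2) L) w).
  rewrite -{1}(Ex_cst (c0 - e / 2)); apply: Ex_le => [||w].
  - exact: intg_cst.
  - by apply: intgD => //; exact: intgZ.
  rewrite indicE; case: (boolP (w \in _)) => [_|].
    by rewrite mulr1; have := Y0 L w; have := ler_norm c0; lra.
  rewrite notin_setE /A /= => /negP; rewrite -ltNge ltr_norml => /andP[+ _].
  by have := XY L w; rewrite mulr0 addr0; lra.
rewrite ExD ?ExZ //; last exact: intgZ.
have := EY L (leq_maxl _ _); have h2 := L1P L (leq_maxr _ _).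
have : `|c0| * Ex (\1_(A (e / 2) L)) <= e / 2.
  apply: le_trans (ler_wpM2l c00 h2) _.
  rewrite mulrA ler_pdivrMr //.
  by nra.
lra.
Qed.

(** With the same event A, Y <= c0 + e/2 + (M + |c0|) 1_A everywhere: the uniform bound M replaces
    nonnegativity on A. *)
Lemma in_prob_ge (Y : nat -> T -> R) c M L0 : 0 <= M -> (forall L, intg (Y L)) ->
  (forall L w, Y L w <= M) -> (forall L w, Y L w <= X L w) ->
  (forall L, (L0 <= L)%N -> c <= Ex (Y L)) -> c <= c0.
Proof.
move=> M0 iY YM YX EY; apply/ler_addgt0Pr => e e0.
set N := M + `|c0|; have N0 : 0 <= N by rewrite addr_ge0.
have den : 0 < 2 * (N + 1) by lra.
have [L1 L1P] := PA (divr_gt0 e0 (ltr0Sn R 1)) (divr_gt0 e0 den).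
set L := maxn L0 L1.
have bA := bmf_intg (bmf_indic (mA (e / 2) L)).
have : Ex (Y L) <= Ex (fun w => (c0 + e / 2) + N * \1_(A (e / 2) L) w).
  apply: Ex_le => [||w] //.
    by apply: intgD => //; [exact: intg_cst|exact: intgZ].
  rewrite indicE; case: (boolP (w \in _)) => [_|].
    by rewrite mulr1 /N; have := YM L w; have := ler_norm (- c0); rewrite normrN; lra.
  rewrite notin_setE /A /= => /negP; rewrite -ltNge ltr_norml => /andP[_].
  by have := YX L w; rewrite mulr0 addr0; lra.
rewrite ExD ?ExZ ?Ex_cst //; [|exact: intg_cst|exact: intgZ].
have := EY L (leq_maxl _ _); have h2 := L1P L (leq_maxr _ _).
have : N * Ex (\1_(A (e / 2) L)) <= e / 2.
  apply: le_trans (ler_wpM2l N0 h2) _.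
  rewrite mulrA ler_pdivrMr //.
  by nra.
lra.
Qed.

End InProbability.
End Expectation.

(** * Products of independent variables *)

Section Independence.
Context (R : realType) (d : measure_display) (T : measurableType d) (P : probability T R).
Local Notation Ex := (Ex P).
Local Notation intg := (intg P).

(** Quantisation with mesh 1/n: since K > n M, the 2 K levels (k - K) / n cover the range of F, and
    exactly one cell contains F x. *)
Lemma simple_approx (F : R -> R) (M : R) n : (0 < n)%N ->
  (forall x, `|F x| <= M) ->
  exists (K : nat) (c : nat -> R),
    forall x, `|F x - \sum_(k < K) c k *
       \1_(F @^-1` `[c k, c k + n%:R^-1[) x| <= n%:R^-1.
Proof.
move=> n0 FM.
have n0' : 0 < n%:R :> R by rewrite ltr0n.
have [K KM] : exists K : nat, n%:R * M < K%:R.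
  by exists (Num.truncn (n%:R * M)).+1; exact: truncnS_gt.
exists (K + K)%N, (fun k => (k%:R - K%:R) / n%:R) => x.
have /andP[F1 F2] : - M <= F x <= M by rewrite -ler_norml.
pose t := n%:R * F x + K%:R.
have tl : 0 <= t.
  by have := ler_wpM2l (ltW n0') F1; rewrite /t mulrN; lra.
have tu : t < (K + K)%:R.
  by have := ler_wpM2l (ltW n0') F2; rewrite /t natrD; lra.
have [k0 k1 k2] : exists2 k0 : nat, k0%:R <= t & t < k0%:R + 1.
  by have /andP[] := truncn_itv tl; exists (Num.truncn t) => //; rewrite natr1.
have k0K : (k0 < K + K)%N by rewrite -(ltr_nat R); exact: le_lt_trans k1 tu.
have E k : (\1_(F @^-1` `[(k%:R - K%:R) / n%:R, (k%:R - K%:R) / n%:R + n%:R^-1[) x : R)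
    = (k == k0)%:R.
  rewrite indicE; congr (_%:R); congr nat_of_bool.
  have D : (k%:R - K%:R) / n%:R + n%:R^-1 = (k%:R - K%:R + 1) / n%:R :> R.
    by field; rewrite gt_eqF.
  apply/idP/eqP; rewrite inE /= in_itv /= D.
    rewrite ler_pdivrMr // ltr_pdivlMr // => /andP[h1 h2].
    apply/eqP; rewrite eqn_leq -(ltnS k) -(ltnS k0) -!(ltr_nat R) -!natr1.
    by move: k1 k2; rewrite /t => k1 k2; apply/andP; split; lra.
  move=> kk; rewrite {}kk ler_pdivrMr // ltr_pdivlMr //.
  by move: k1 k2; rewrite /t => k1 k2; apply/andP; split; lra.
rewrite (bigD1 (Ordinal k0K)) //= E eqxx mulr1 big1 ?addr0; last first.
  move=> i ik; rewrite E; case: eqP => [h|]; last by rewrite mulr0.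
  by move/eqP: ik; case; apply: val_inj.
have -> : F x - (k0%:R - K%:R) / n%:R = (t - k0%:R) / n%:R.
  by rewrite /t; field; rewrite gt_eqF.
rewrite normrM normfV (ger0_norm (ltW n0')) ler_pdivrMr // mulVf ?gt_eqF //.
by rewrite ger0_norm; lra.
Qed.

(** The product rule passes from indicators to their combinations [G] by linearity, then to [F] by
    uniform approximation: the error is at most 2 B / n, where B bounds |Z|. *)
Lemma Ex_factor (X Z : T -> R) (F : R -> R) (M : R) :
  measurable_fun setT X -> measurable_fun setT F -> (forall x, `|F x| <= M) -> bmf Z ->
  (forall A, measurable A -> Ex (fun w => \1_A (X w) * Z w) =
     Ex (fun w => \1_A (X w)) * Ex Z) ->
  Ex (fun w => F (X w) * Z w) = Ex (fun w => F (X w)) * Ex Z.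
Proof.
move=> mX mF FM bZ hA; apply/eqP; rewrite -subr_eq0 -normr_le0; apply/ler_addgt0Pr => e e0.
rewrite add0r; have [_ [B ZB]] := bZ.
have B0 : 0 <= B by apply: le_trans (ZB point).
pose n := (Num.truncn (2 * B / e)).+1.
have n0 : 0 < n%:R :> R by [].
have nB : 2 * B / e < n%:R by exact: truncnS_gt.
have [K [c Fc]] := simple_approx (ltn0Sn _ : (0 < n)%N) FM.
set A := fun k => (F @^-1` `[c k, c k + n%:R^-1[) in Fc.
have mA k : measurable (A k).
  by rewrite -[A k]setTI; apply: mF => //; exact: measurable_itv.
have bX k : bmf (fun w => \1_(A k) (X w)).
  split; first by apply: measurableT_comp => //; exact: measurable_indic.
  by exists 1 => w; rewrite indicE; case: (_ \in _); rewrite ?normr1 ?normr0.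
pose G w := \sum_(k < K) c k * \1_(A k) (X w).
have bcX k : bmf (fun w => c k * \1_(A k) (X w)) by apply: bmfM => //; exact: bmf_cst.
have bG : bmf G by apply: bmf_sum => k.
have GE : Ex (fun w => G w * Z w) = Ex G * Ex Z.
  under eq_fun do rewrite mulr_suml; rewrite !Ex_sum => [|i|i].
  - rewrite mulr_suml; apply: eq_bigr => k _.
    under eq_fun do rewrite -mulrA; rewrite !ExZ ?hA ?mulrA //; apply: bmf_intg => //.
    exact: bmfM.
  - exact: bmf_intg.
  - by apply: bmf_intg; exact: bmfM.
have bF : bmf (fun w => F (X w)) by split; [exact: measurableT_comp|exists M].
have FG w : `|F (X w) - G w| <= n%:R^-1 by exact: Fc.
have bFG : bmf (fun w => F (X w) - G w) by exact: bmfB.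
have -> : Ex (fun w => F (X w) * Z w) - Ex (fun w => F (X w)) * Ex Z =
   Ex (fun w => (F (X w) - G w) * Z w) - Ex (fun w => F (X w) - G w) * Ex Z.
  under [X in _ = Ex X - _]eq_fun do rewrite mulrBl.
  rewrite !ExB ?GE; try (by apply: bmf_intg => //; apply: bmfM).
  by ring.
have h1 : `|Ex (fun w => (F (X w) - G w) * Z w)| <= B / n%:R.
  apply: le_trans (Ex_abs (bmf_intg P (bmfM bFG bZ))) _.
  rewrite -[leRHS](Ex_cst P); apply: Ex_le => [||w].
  - exact/intg_abs/bmf_intg/bmfM.
  - exact: intg_cst.
  - by rewrite normrM mulrC ler_pM.
have h2 : `|Ex (fun w => F (X w) - G w)| <= n%:R^-1.
  apply: le_trans (Ex_abs (bmf_intg P bFG)) _.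
  rewrite -[leRHS](Ex_cst P); apply: Ex_le => [||w] //.
  - exact/intg_abs/bmf_intg.
  - exact: intg_cst.
have h3 : `|Ex Z| <= B.
  apply: le_trans (Ex_abs (bmf_intg P bZ)) _.
  rewrite -[leRHS](Ex_cst P); apply: Ex_le => [||w] //.
  - exact/intg_abs/bmf_intg.
  - exact: intg_cst.
apply: le_trans (ler_normB _ _) _; rewrite normrM.
have h4 : `|Ex (fun w => F (X w) - G w)| * `|Ex Z| <= n%:R^-1 * B by exact: ler_pM.
have : 2 * B / n%:R <= e.
  by rewrite ler_pdivrMr // -ler_pdivrMl // mulrC ltW.
have -> : 2 * B / n%:R = B / n%:R + n%:R^-1 * B by field; rewrite gt_eqF.
lra.
Qed.

Variables (I : choiceType) (r : I -> T -> R).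
Hypothesis mr : forall i, measurable_fun setT (r i).
Hypothesis indr : forall s : seq I, uniq s -> forall A : I -> set R,
  (forall i, measurable (A i)) ->
  P (\bigcap_(i in [set` s]) (r i @^-1` A i)) = (\prod_(i <- s) P (r i @^-1` A i))%E.

Lemma Ex_prod_indic (s : seq I) (A : I -> set R) : uniq s ->
  (forall i, measurable (A i)) ->
  Ex (fun w => \prod_(i <- s) \1_(A i) (r i w)) = \prod_(i <- s) Ex (fun w => \1_(A i) (r i w)).
Proof.
move=> us mA.
have mrA i : measurable (r i @^-1` A i).
  by rewrite -[X in measurable X]setTI; exact: mr.
have E i : Ex (fun w => \1_(A i) (r i w)) = fine (P (r i @^-1` A i)).
  by rewrite -Ex_indic //; congr Ex; apply/funext => w; rewrite !indicE; congr (_%:R);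
    congr nat_of_bool; apply/idP/idP; rewrite !inE.
under [RHS]eq_bigr do rewrite E.
have -> : (fun w => \prod_(i <- s) \1_(A i) (r i w)) =
    \1_(\bigcap_(i in [set` s]) (r i @^-1` A i)) :> (T -> R).
  apply/funext => w; rewrite indicE; case: (boolP (w \in _)); rewrite ?inE ?notin_setE.
    move=> h; rewrite big_seq big1 // => i si; rewrite indicE mem_set //.
    exact: h.
  move=> /existsNP[i /not_implyP[si nA]].
  by rewrite (big_rem i) //= indicE memNset // mul0r.
rewrite Ex_indic; last first.
  rewrite bigcap_seq; apply: bigsetI_measurable => i _; exact: mrA.
rewrite indr //; elim: s {us} => [|i s IH]; first by rewrite !big_nil.
rewrite !big_cons fineM ?IH //; first exact: fin_num_measure.
elim: s {IH} => [|j s IH]; first by rewrite big_nil.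
by rewrite big_cons fin_numM // fin_num_measure.
Qed.

Lemma Ex_prod (s : seq I) (g : I -> R -> R) : uniq s ->
  (forall i, measurable_fun setT (g i)) -> (forall i, exists M, forall x, `|g i x| <= M) ->
  Ex (fun w => \prod_(i <- s) g i (r i w)) = \prod_(i <- s) Ex (fun w => g i (r i w)).
Proof.
move=> us mg bg.
(* Factors are changed from indicators to general functions one at a time; the induction therefore
   carries a mixed product. *)
suff gen : forall (s1 s2 : seq I) (A : I -> set R), uniq (s1 ++ s2) ->
  (forall i, measurable (A i)) ->
  Ex (fun w => \prod_(i <- s1) g i (r i w) * \prod_(i <- s2) \1_(A i) (r i w)) =
  \prod_(i <- s1) Ex (fun w => g i (r i w)) * \prod_(i <- s2) Ex (fun w => \1_(A i) (r i w)).
  have := gen s [::] (fun=> setT); rewrite cats0 big_nil mulr1 => <- //.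
  by congr Ex; apply/funext => w; rewrite big_nil mulr1.
have bgr i : bmf (fun w => g i (r i w)).
  by split; [exact: measurableT_comp|have [M gM] := bg i; exists M].
elim=> [|i s1 IH] s2 A us12 mA.
  rewrite big_nil mul1r -Ex_prod_indic //.
  by congr Ex; apply/funext => w; rewrite big_nil mul1r.
have bA (B : I -> set R) j : (forall i, measurable (B i)) -> bmf (fun w => \1_(B j) (r j w)).
  move=> mB; split; first by apply: measurableT_comp => //; exact: measurable_indic.
  by exists 1 => w; rewrite indicE; case: (_ \in _); rewrite ?normr1 ?normr0.
move: us12; rewrite /= => /andP[ni us12].
have [M gM] := bg i.
under eq_fun do rewrite big_cons -mulrA.
rewrite (@Ex_factor (r i) _ (g i) M) //.
- by rewrite IH // big_cons mulrA.
- by apply: bmfM; apply: bmf_prod => j; [exact: bgr|exact: bA].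
move=> B mB; rewrite IH //.
(* The index i joins the indicator factors with the set B; overwriting [A] at i is harmless since i
   does not occur in [s2]. *)
pose A' j := if j == i then B else A j.
have AA' j : j \in s2 -> A' j = A j.
  rewrite /A'; case: eqP => // -> js2.
  by move: ni; rewrite mem_cat js2 orbT.
have u' : uniq (s1 ++ i :: s2).
  rewrite (perm_uniq (_ : perm_eq _ ([:: i] ++ s1 ++ s2))) /= ?ni //.
  by rewrite -cat1s perm_catCA.
have h := IH (i :: s2) A' u' _.
have -> : (fun w => \1_B (r i w) *
      (\prod_(j <- s1) g j (r j w) * \prod_(j <- s2) \1_(A j) (r j w))) =
    (fun w => \prod_(j <- s1) g j (r j w) * \prod_(j <- i :: s2) \1_(A' j) (r j w)).
  apply/funext => w; rewrite big_cons {1}/A' eqxx mulrCA; congr (_ * (_ * _)).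
  by apply: eq_big_seq => j js2; rewrite AA'.
rewrite h ?big_cons {1}/A' ?eqxx; last by move=> j; rewrite /A'; case: eqP.
rewrite mulrCA; congr (_ * (_ * _)).
by apply: eq_big_seq => j js2; rewrite AA'.
Qed.

End Independence.

(** * Concentration, laws and truncation *)

Section Concentration.
Context (R : realType) (d : measure_display) (T : measurableType d) (P : probability T R).
Local Notation Ex := (Ex P).
Local Notation intg := (intg P).

(** Chebyshev's argument, stated in mean: the covariances vanish, so the centred sum S has E S^2 <=
    L C, with C = 4 M^2 bounding each centred square. *)
Lemma mean_concentration (W : nat -> T -> R) (M rho eta : R) :
  (forall l, measurable_fun setT (W l)) -> (forall l w, `|W l w| <= M) ->
  (forall l, Ex (W l) = rho) ->
  (forall l k, l != k -> Ex (fun w => W l w * W k w) = rho ^+ 2) -> 0 < eta ->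
  exists L0, forall L, (L0 <= L)%N ->
    Ex (fun w => `|L%:R^-1 * (\sum_(l < L) W l w) - rho|) <= eta.
Proof.
move=> mW WM EW EWW eta0.
have bW l : bmf (W l) by split=> //; exists M.
pose V l w := W l w - rho.
have bV l : bmf (V l) by apply: bmfB => //; exact: bmf_cst.
have M0 : 0 <= M by apply: le_trans (WM 0%N point).
have rhoM : `|rho| <= M.
  rewrite -(EW 0%N); apply: le_trans (Ex_abs (bmf_intg P (bW 0%N))) _.
  rewrite -[leRHS](Ex_cst P); apply: Ex_le => //; last exact: intg_cst.
  exact/intg_abs/bmf_intg.
pose C := 4 * M ^+ 2.
have C0 : 0 <= C by rewrite mulr_ge0 // sqr_ge0.
have VC l w : V l w ^+ 2 <= C.
  have : `|V l w| <= 2 * M.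
    by apply: le_trans (ler_normB _ _) _; have := WM l w; lra.
  rewrite -(@ler_pXn2r _ 2) ?nnegrE ?mulr_ge0 // real_normK ?num_real //.
  by rewrite exprMn /C => h; apply: le_trans h _; rewrite -natrX.
have EVV l k : Ex (fun w => V l w * V k w) <= if l == k then C else 0.
  case: eqP => [->|/eqP lk].
    rewrite -[leRHS](Ex_cst P); apply: Ex_le => [||w]; last by rewrite -expr2.
      exact/bmf_intg/bmfM.
    exact: intg_cst.
  have -> : (fun w => V l w * V k w) =
     (fun w => W l w * W k w + (- rho * W l w + (- rho * W k w + rho ^+ 2))).
    by apply/funext => w; rewrite /V; ring.
  have iW j := bmf_intg P (bW j).
  have i1 j : intg (fun w => - rho * W j w) by exact: intgZ.
  have i2 : intg (fun w => - rho * W k w + rho ^+ 2).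
    by apply: intgD => //; exact: intg_cst.
  rewrite ExD ?EWW //; [|exact/bmf_intg/bmfM|exact: intgD].
  rewrite ExD // ExD // ?Ex_cst ?ExZ ?EW //; last exact: intg_cst.
  by rewrite le_eqVlt; apply/orP; left; apply/eqP; ring.
(* Beyond this threshold C / (L eta^2) <= 1, so the quadratic term below has mean at most eta /
   2. *)
exists (Num.truncn (C / eta ^+ 2)).+1 => L LL.
have LC : C / eta ^+ 2 < L%:R.
  by apply: lt_le_trans (truncnS_gt _) _; rewrite ler_nat.
have L0 : 0 < L%:R :> R.
  by apply: le_lt_trans LC; rewrite divr_ge0 // exprn_ge0 // ltW.
pose S w := \sum_(l < L) V l w.
have bS : bmf S by apply: bmf_sum.
have SE w : L%:R^-1 * (\sum_(l < L) W l w) - rho = L%:R^-1 * S w.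
  rewrite /S /V sumrB sumr_const card_ord mulrBr -mulr_natr; field.
  by rewrite gt_eqF.
have ES : Ex (fun w => S w * S w) <= L%:R * C.
  under eq_fun do rewrite {1}/S mulr_suml.
  rewrite Ex_sum; last by move=> l; exact/bmf_intg/bmfM.
  apply: le_trans (_ : \sum_(l < L) C <= _); last first.
    by rewrite sumr_const card_ord mulr_natl.
  apply: ler_sum => l _; under eq_fun do rewrite /S mulr_sumr.
  rewrite Ex_sum; last by move=> k; exact/bmf_intg/bmfM.
  apply: le_trans (_ : \sum_(k < L) (if (l : nat) == k then C else 0) <= _).
    by apply: ler_sum => k _; exact: EVV.
  rewrite (bigD1 l) //= eqxx big1 ?addr0 // => k kl.
  by rewrite eq_sym (negbTE (kl : (k : nat) != l)).
(* AM-GM: [|x| <= eta / 2 + x^2 / (2 eta)] *)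
have : Ex (fun w => `|L%:R^-1 * (\sum_(l < L) W l w) - rho|) <=
    Ex (fun w => eta / 2 + (L%:R ^- 2 / (2 * eta)) * (S w * S w)).
  have bSS : bmf (fun w => S w * S w) by exact: bmfM.
  apply: Ex_le => [||w].
  - apply/intg_abs/bmf_intg; under eq_fun do rewrite SE.
    by apply: bmfM => //; exact: bmf_cst.
  - by apply: intgD; [exact: intg_cst|apply: intgZ; exact: bmf_intg].
  rewrite SE; set x := L%:R^-1 * S w.
  have -> : L%:R ^- 2 / (2 * eta) * (S w * S w) = x ^+ 2 / (2 * eta).
    by rewrite /x exprMn exprVn; ring.
  have -> : eta / 2 + x ^+ 2 / (2 * eta) = `|x| + (`|x| - eta) ^+ 2 / (2 * eta).
    by rewrite -(real_normK (num_real x)); field; rewrite gt_eqF.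
  by rewrite lerDl divr_ge0 ?sqr_ge0 // mulr_ge0 // ltW.
move=> /le_trans; apply; rewrite ExD ?Ex_cst ?ExZ //.
- have : L%:R ^- 2 / (2 * eta) * Ex (fun w => S w * S w) <= eta / 2; last by lra.
  apply: le_trans (ler_wpM2l _ ES) _.
    by rewrite divr_ge0 ?mulr_ge0 // ?invr_ge0 ?exprn_ge0 // ltW.
  have -> : L%:R ^- 2 / (2 * eta) * (L%:R * C) = (C / eta ^+ 2) / L%:R * (eta / 2).
    by field; rewrite !gt_eqF.
  rewrite ler_piMl //; first by rewrite divr_ge0 // ltW.
  by rewrite ler_pdivrMr // mul1r ltW.
- exact/bmf_intg/bmfM.
- exact: intg_cst.
- by apply/intgZ/bmf_intg/bmfM.
Qed.

End Concentration.

Section Law.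
Context (R : realType) (d : measure_display) (T : measurableType d) (P : probability T R).

(** Rectangles are stable under intersection and generate the Borel sets of the plane, so the two
    image measures coincide; both expectations are integrals of F against them. *)
Lemma eq_law (X Y : T -> R * R) : measurable_fun setT X -> measurable_fun setT Y ->
  (forall A B, measurable A -> measurable B ->
     P (X @^-1` (A `*` B)) = P (Y @^-1` (A `*` B))) ->
  forall F : R * R -> R, measurable_fun setT F -> (forall x, 0 <= F x) ->
  Ex P (F \o X) = Ex P (F \o Y).
Proof.
move=> mX mY XY F mF F0; rewrite /Ex /Rintegral; congr fine.
pose X' : {mfun T >-> (R * R)%type} := HB.pack X (isMeasurableFun.Build _ _ _ _ _ mX).
pose Y' : {mfun T >-> (R * R)%type} := HB.pack Y (isMeasurableFun.Build _ _ _ _ _ mY).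
have mEF : measurable_fun setT (EFin \o F) by exact/measurable_EFinP.
have EX := @ge0_integral_pushforward _ _ _ _ _ _ mX P setT (EFin \o F) measurableT mEF
  (fun x _ => F0 x).
have EY := @ge0_integral_pushforward _ _ _ _ _ _ mY P setT (EFin \o F) measurableT mEF
  (fun x _ => F0 x).
rewrite !preimage_setT in EX EY; rewrite -[LHS]EX -[RHS]EY.
apply: (eq_measure_integral (pushforward P Y')) => A mA _ /=.
pose G : set (set (R * R)%type) :=
  [set A `*` B | A in @measurable _ R & B in @measurable _ R].
apply: (@measure_unique _ _ _ G (fun=> setT) _ _ _ _ (pushforward P X') (pushforward P Y')) => //.
- by rewrite measurable_prod_measurableType.
- move=> _ _ [A1 mA1 [B1 mB1 <-]] [A2 mA2 [B2 mB2 <-]]; rewrite -setXI.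
  by exists (A1 `&` A2); [exact: measurableI|exists (B1 `&` B2) => //; exact: measurableI].
- by move=> _; exists setT => //; exists setT => //; rewrite setXTT.
- by rewrite bigcup_const.
- by move=> _ [A1 mA1 [B1 mB1 <-]]; exact: XY.
- by move=> _ /=; rewrite /pushforward preimage_setT; apply: le_lt_trans (probability_le1 P measurableT) _; rewrite ltry.
Qed.

(** Large values are sent to 0, not clamped: [trunc B x] and its complement are each x or 0, so both
    squares are at most x^2. *)
Definition trunc (B x : R) : R := x * (`|x| <= B)%R%:R.

Lemma measurable_trunc B : measurable_fun setT (trunc B).
Proof.
apply: measurable_funM => //.
rewrite (_ : (fun x : R => _) = \1_[set x | `|x| <= B]).
  apply: measurable_indic; rewrite -[X in measurable X]setTI.
  by apply: measurable_fun_le => //; exact: measurableT_comp.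
apply/funext => x; rewrite indicE; congr (_%:R); congr nat_of_bool.
by apply/idP/idP; rewrite inE.
Qed.

Lemma trunc_bound B x : 0 <= B -> `|trunc B x| <= B.
Proof.
move=> B0; rewrite /trunc; case: (boolP (`|x| <= B)) => h; first by rewrite mulr1.
by rewrite mulr0 normr0.
Qed.

Lemma trunc_sqr_le B x : trunc B x ^+ 2 <= x ^+ 2.
Proof.
rewrite /trunc; case: (`|x| <= B); first by rewrite mulr1.
by rewrite mulr0 expr0n sqr_ge0.
Qed.

Lemma trunc_diff_sqr_le B x : (x - trunc B x) ^+ 2 <= x ^+ 2.
Proof.
rewrite /trunc; case: (`|x| <= B); first by rewrite mulr1 subrr expr0n sqr_ge0.
by rewrite mulr0 subr0.
Qed.

(** Dominated convergence: at each w the residue is 0 once B >= |u w|, and its square is dominated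
    by u^2. *)
Lemma trunc_error (u : T -> R) (delta : R) : measurable_fun setT u ->
  intg P (fun w => u w ^+ 2) -> 0 < delta ->
  exists2 B, 0 <= B & Ex P (fun w => (u w - trunc B (u w)) ^+ 2) <= delta.
Proof.
move=> mu iu d0.
have mt n : measurable_fun setT (fun w => (u w - trunc n%:R (u w)) ^+ 2).
  apply: measurable_funX; apply: measurable_funB => //.
  by apply: measurableT_comp => //; exact: measurable_trunc.
have cvg0 w : (fun n => ((u w - trunc n%:R (u w)) ^+ 2)%:E) @ \oo --> 0%E.
  apply: cvg_near_cst; exists (Num.truncn `|u w|).+1 => // n /= hn.
  rewrite /trunc (_ : _ <= _ = true) ?mulr1 ?subrr ?expr0n //.
  by apply: le_trans (ltW (truncnS_gt _)) _; rewrite ler_nat.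
have dom w n : setT w ->
    (`|((u w - trunc n%:R (u w)) ^+ 2)%:E| <= (u w ^+ 2)%:E)%E.
  by move=> _; rewrite /= lee_fin ger0_norm ?sqr_ge0 //; exact: trunc_diff_sqr_le.
have [_ _] := @dominated_convergence _ _ _ P setT measurableT
  (fun n w => ((u w - trunc n%:R (u w)) ^+ 2)%:E) (cst 0%E) (fun w => (u w ^+ 2)%:E)
  (fun n => (measurable_EFinP _ _).2 (mt n)) (measurable_cst _)
  (aeW P (fun w _ => cvg0 w)) iu
  (aeW P dom).
rewrite integral_cst // mul0e => /fine_cvgP[_ /cvgrPdist_le /(_ _ d0)[n _ nP]].
exists n%:R => //; have := nP n (leqnn n).
by rewrite /= sub0r normrN => h; apply: le_trans (ler_norm _) h.
Qed.

End Law.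

(** * The Rician channel *)

Lemma sum_ord_const (R : pzRingType) n (x : R) : \sum_(i < n) x = n%:R * x.
Proof. by rewrite sumr_const card_ord mulr_natl. Qed.

Section Gram.
Variables (R : realType) (N L : nat).
Local Notation C := R[i].

Lemma cabs_le_ReIm (z : C) : cabs z <= `|complex.Re z| + `|complex.Im z|.
Proof.
rewrite /cabs -(ler_pXn2r (n := 2)) ?nnegrE ?sqrtr_ge0 ?addr_ge0 //.
rewrite sqr_sqrtr ?addr_ge0 ?sqr_ge0 // sqrrD !real_normK ?num_real //.
by rewrite lerD2r lerDl mulrn_wge0 // mulr_ge0.
Qed.

Lemma cabsJ (z : C) : cabs (z^*)%C = cabs z.
Proof. by case: z => a b; rewrite /cabs /= sqrrN. Qed.

Lemma csq_le_sqnormc (y : 'cV[C]_N) n : csq (y n 0) <= sqnormc y.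
Proof.
rewrite /sqnormc (bigD1 n) //= lerDl; apply: sumr_ge0 => m _; exact: csq_ge0.
Qed.

(** The left side is y^H H H^H y, and H H^H / L is entrywise within E of mu2 J + nu I, where J is
    the all-ones matrix. Cauchy-Schwarz gives y^H J y <= N |y|^2, and each error entry contributes
    at most E n m times |y_n| |y_m| <= |y|^2. *)
Lemma beam_gram_le (H : 'M[C]_(N, L)) (mu2 nu : R) (E : 'I_N -> 'I_N -> R) y :
  (0 < L)%N -> 0 <= mu2 ->
  (forall n m, cabs ((L%:R^-1)%:C%C * (\sum_l H n l * ((H m l)^*)%C)
     - ((mu2 + nu * (n == m)%:R)%:C)%C) <= E n m) ->
  \sum_l csq (beam H y l) <= L%:R * (mu2 * N%:R + nu + \sum_n \sum_m E n m) * sqnormc y.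
Proof.
move=> L0 mu20 hE; have L0' : 0 < L%:R :> R by rewrite ltr0n.
pose e n m := (L%:R^-1)%:C%C * (\sum_l H n l * ((H m l)^*)%C)
     - ((mu2 + nu * (n == m)%:R)%:C)%C.
have eE n m : \sum_l H n l * ((H m l)^*)%C =
   (L%:R%:C)%C * (((mu2 + nu * (n == m)%:R)%:C)%C + e n m).
  rewrite /e [X in _ * X]addrC subrK mulrA -rmorphM /= mulfV ?gt_eqF //.
  by rewrite mul1r.
have ReZ (r : R) (z : C) : complex.Re ((r%:C)%C * z) = r * complex.Re z.
  by case: z => p q /=; rewrite mul0r subr0.
have -> : \sum_l csq (beam H y l) = complex.Re (\sum_n \sum_m
    (((y n 0)^*)%C * y m 0) * \sum_l H n l * ((H m l)^*)%C).
  have -> : \sum_l csq (beam H y l) = complex.Re (\sum_l beam H y l * ((beam H y l)^*)%C).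
    by rewrite Re_sum; apply: eq_bigr => l _; rewrite csqE.
  congr complex.Re; under eq_bigr => l _.
    rewrite {2}/beam conjc_sum /beam mulr_suml.
    under eq_bigr => n _.
      rewrite mulr_sumr; under eq_bigr => m _ do rewrite rmorphM /= conjcK mulrACA.
      over.
    over.
  rewrite exchange_big /=; apply: eq_bigr => n _.
  rewrite exchange_big /=; apply: eq_bigr => m _.
  by rewrite mulr_sumr.
have -> : (\sum_n \sum_m (((y n 0)^*)%C * y m 0) * \sum_l H n l * ((H m l)^*)%C) =
   (L%:R%:C)%C * ((mu2%:C)%C * (((\sum_n y n 0)^*)%C * (\sum_n y n 0))
     + (nu%:C)%C * (\sum_n ((y n 0)^*)%C * y n 0)
     + \sum_n \sum_m (((y n 0)^*)%C * y m 0) * e n m).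
  rewrite conjc_sum mulr_suml !mulr_sumr -!big_split /= mulr_sumr.
  apply: eq_bigr => n _.
  have -> : (nu%:C)%C * (((y n 0)^*)%C * y n 0) =
     \sum_m (((nu * (n == m)%:R)%:C)%C * (((y n 0)^*)%C * y m 0)).
    rewrite (bigD1 n) //= eqxx mulr1 big1 ?addr0 // => m mn.
    by rewrite eq_sym (negbTE mn) mulr0 mul0r.
  rewrite !mulr_sumr -!big_split /= mulr_sumr; apply: eq_bigr => m _.
  by rewrite eE rmorphD /=; ring.
rewrite ReZ -mulrA ler_wpM2l ?(ltW L0') // !ReD !ReZ !mulrDl.
have conjcM (z : C) : ((z^*)%C * z) = ((csq z)%:C)%C by rewrite mulrC csqE.
apply: lerD; first apply: lerD.
- rewrite conjcM /= -mulrA ler_wpM2l //.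
  rewrite [X in csq X](eq_bigr (fun n => y n 0 * 1)); last by move=> n _; rewrite mulr1.
  apply: le_trans (csq_sum_le _ _) _.
  rewrite (_ : \sum_(i < N) csq (1 : C) = N%:R) 1?mulrC //.
  by rewrite /csq /= expr1n expr0n addr0 sumr_const card_ord.
- under eq_bigr do rewrite conjcM.
  by rewrite Re_sum /=.
- rewrite Re_sum mulr_suml; apply: ler_sum => n _.
  rewrite Re_sum mulr_suml; apply: ler_sum => m _.
  apply: le_trans (Re_le_cabs _) _; rewrite !cabsM cabsJ mulrC.
  apply: ler_pM => //; rewrite ?cabs_ge0 //; first by rewrite mulr_ge0 ?cabs_ge0.
  - exact: hE.
  have h1 := csq_le_sqnormc y n; have h2 := csq_le_sqnormc y m.
  rewrite -!cabs_sqr in h1 h2.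
  have := sqr_ge0 (cabs (y n 0) - cabs (y m 0)); nra.
Qed.

End Gram.

Section Model.
Context (R : realType) (d : measure_display) (T : measurableType d) (P : probability T R).
Local Notation C := R[i].
Local Notation Ex := (Ex P).
Local Notation intg := (intg P).
Variables (g : nat -> nat -> T -> C) (mu c : R).
Hypotheses (muc : mu ^+ 2 + c ^+ 2 = 1)
  (mg : forall n l, cmeasurable (g n l))
  (ig : cindep P (fun nl : nat * nat => g nl.1 nl.2))
  (eg : cident P (fun nl : nat * nat => g nl.1 nl.2))
  (sg : forall n l, intg (fun w => csq (g n l w)))
  (zRe : forall n l, Ex (fun w => complex.Re (g n l w)) = 0)
  (zIm : forall n l, Ex (fun w => complex.Im (g n l w)) = 0)
  (oneg : forall n l, Ex (fun w => csq (g n l w)) = 1).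

Definition gpart (b : bool) n l (w : T) : R :=
  if b then complex.Re (g n l w) else complex.Im (g n l w).

Lemma measurable_gpart b n l : measurable_fun setT (gpart b n l).
Proof. by case: b; case: (mg n l). Qed.

Lemma intg_gpart_sqr b n l : intg (fun w => gpart b n l w ^+ 2).
Proof.
apply: intg_le (sg n l) _.
  by apply: measurable_funX; exact: measurable_gpart.
move=> w; rewrite ger0_norm ?sqr_ge0 // /csq /gpart.
by case: b; rewrite ?lerDl ?lerDr sqr_ge0.
Qed.

Lemma intg_gpart b n l : intg (gpart b n l).
Proof.
have i1 : intg (fun w => 1 + gpart b n l w ^+ 2).
  by apply: intgD; [exact: intg_cst|exact: intg_gpart_sqr].
apply: intg_le i1 _; first exact: measurable_gpart.
move=> w; rewrite -[in leRHS](real_normK (num_real _)).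
have := sqr_ge0 (`|gpart b n l w| - 1); have := normr_ge0 (gpart b n l w); nra.
Qed.

Lemma Ex_gpart b n l : Ex (gpart b n l) = 0.
Proof. by case: b; [exact: zRe|exact: zIm]. Qed.

Lemma Ex_gpart_sqr n l :
  Ex (fun w => gpart true n l w ^+ 2) + Ex (fun w => gpart false n l w ^+ 2) = 1.
Proof.
by rewrite -ExD; [exact: oneg|exact: intg_gpart_sqr|exact: intg_gpart_sqr].
Qed.

Lemma Ex_law (F : R * R -> R) n l n' l' : measurable_fun setT F -> (forall x, 0 <= F x) ->
  Ex (fun w => F (complex.Re (g n l w), complex.Im (g n l w))) =
  Ex (fun w => F (complex.Re (g n' l' w), complex.Im (g n' l' w))).
Proof.
move=> mF F0; apply: (@eq_law _ _ _ P
  (fun w => (complex.Re (g n l w), complex.Im (g n l w)))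
  (fun w => (complex.Re (g n' l' w), complex.Im (g n' l' w)))) => //.
- by apply: measurable_fun_pair; case: (mg n l).
- by apply: measurable_fun_pair; case: (mg n' l').
- by move=> A B mA mB; exact: (eg (n, l) (n', l') mA mB).
Qed.

Lemma Ex_gpart_law (F : R -> R) b n l n' l' : measurable_fun setT F -> (forall x, 0 <= F x) ->
  Ex (fun w => F (gpart b n l w)) = Ex (fun w => F (gpart b n' l' w)).
Proof.
move=> mF F0; case: b.
  apply: (@Ex_law (F \o fst)) => [|x]; last exact: F0.
  exact: (measurableT_comp mF measurable_fst).
apply: (@Ex_law (F \o snd)) => [|x]; last exact: F0.
exact: (measurableT_comp mF measurable_snd).
Qed.

(** Adding the constant M reduces this to the nonnegative case. *)
Lemma Ex_gpart_law_bounded (F : R -> R) M b n l n' l' : measurable_fun setT F ->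
  (forall x, `|F x| <= M) ->
  Ex (fun w => F (gpart b n l w)) = Ex (fun w => F (gpart b n' l' w)).
Proof.
move=> mF FM.
have i0 j k : intg (fun w => F (gpart b j k w)).
  apply: bmf_intg; split; last by exists M.
  by apply: measurableT_comp => //; exact: measurable_gpart.
have := @Ex_gpart_law (fun x => F x + M) b n l n' l' _ _.
rewrite !ExD ?Ex_cst //; try exact: intg_cst.
move=> h; apply: (addIr M); apply: h; first exact: measurable_funD.
by move=> x; have := FM x; rewrite ler_norml => /andP[]; lra.
Qed.

(** The selector picks one part per entry, since the two parts of the same entry may be dependent;
    the other side of the rectangle is then the whole line. *)
Lemma gpart_indep (sel : nat * nat -> bool) (s : seq (nat * nat)) : uniq s ->
  forall A : nat * nat -> set R, (forall i, measurable (A i)) ->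
  P (\bigcap_(i in [set` s]) (gpart (sel i) i.1 i.2 @^-1` A i)) =
  (\prod_(i <- s) P (gpart (sel i) i.1 i.2 @^-1` A i))%E.
Proof.
move=> us A mA.
have E i : gpart (sel i) i.1 i.2 @^-1` A i =
    cevent (g i.1 i.2) (if sel i then A i else setT) (if sel i then setT else A i).
  by rewrite /cevent /gpart; apply/seteqP; split=> w /=; case: (sel i) => //=; tauto.
under eq_bigcapr do rewrite E; under eq_bigr do rewrite E.
by apply: ig => // i; case: (sel i); split.
Qed.

Lemma Ex_gpart_prod (sel : nat * nat -> bool) (s : seq (nat * nat)) (f : bool -> R -> R) M :
  uniq s -> (forall b, measurable_fun setT (f b)) -> (forall b x, `|f b x| <= M) ->
  Ex (fun w => \prod_(i <- s) f (sel i) (gpart (sel i) i.1 i.2 w)) =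
  \prod_(i <- s) Ex (fun w => f (sel i) (gpart (sel i) 0%N 0%N w)).
Proof.
move=> us mf fM.
rewrite (@Ex_prod _ _ _ P _ (fun i => gpart (sel i) i.1 i.2) _ _ s (fun i => f (sel i))) //.
- by apply: eq_bigr => i _; exact: Ex_gpart_law_bounded (mf _) (fM _).
- by move=> i; exact: measurable_gpart.
- exact: gpart_indep.
- by move=> i; exists M.
Qed.

Definition chan n l w : C := ((mu%:C)%C + (c%:C)%C * g n l w).

Lemma Re_chan n l w : complex.Re (chan n l w) = mu + c * gpart true n l w.
Proof. by rewrite /chan /gpart; case: (g n l w) => a b /=; rewrite mul0r subr0. Qed.

Lemma Im_chan n l w : complex.Im (chan n l w) = c * gpart false n l w.
Proof. by rewrite /chan /gpart; case: (g n l w) => a b /=; rewrite mul0r addr0 add0r. Qed.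

Lemma csq_chan n l w : csq (chan n l w) =
  mu ^+ 2 + 2 * mu * c * gpart true n l w + c ^+ 2 * csq (g n l w).
Proof. rewrite /csq Re_chan Im_chan /gpart; ring. Qed.

Lemma cmeasurable_chan n l : cmeasurable (chan n l).
Proof.
have mp b : measurable_fun setT (fun w => c * gpart b n l w).
  by apply: measurable_funM => //; exact: measurable_gpart.
split.
  by under eq_fun do rewrite Re_chan; exact: measurable_funD.
under eq_fun do rewrite Im_chan; exact: (mp false).
Qed.

Lemma intg_csq_chan n l : intg (fun w => csq (chan n l w)).
Proof.
under eq_fun do rewrite csq_chan.
by apply: intgD; [apply: intgD; [exact: intg_cst|exact/intgZ/intg_gpart]|exact: intgZ].
Qed.

Lemma Ex_csq_chan n l : Ex (fun w => csq (chan n l w)) = 1.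
Proof.
under eq_fun do rewrite csq_chan.
have i1 := intgZ (2 * mu * c) (intg_gpart true n l).
have i2 := intgD (intg_cst P (mu ^+ 2)) i1; have i3 := intgZ (c ^+ 2) (sg n l).
rewrite (ExD i2 i3) (ExD (intg_cst P _) i1) Ex_cst (ExZ _ (intg_gpart true n l)).
by rewrite (ExZ _ (sg n l)) Ex_gpart oneg mulr0 addr0 mulr1.
Qed.

Lemma measurable_cabs_chan n l : measurable_fun setT (fun w => cabs (chan n l w)).
Proof.
have [m1 m2] := cmeasurable_chan n l.
rewrite (_ : (fun w => _) = Num.sqrt \o (fun w => csq (chan n l w))) //.
apply: measurableT_comp.
  by apply: continuous_measurable_fun; exact: sqrt_continuous.
by apply: measurable_funD; exact: measurable_funX.
Qed.

Lemma intg_cabs_chan n l : intg (fun w => cabs (chan n l w)).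
Proof.
apply: intg_le (intgD (intg_cst P 1) (intg_csq_chan n l)) _.
  exact: measurable_cabs_chan.
move=> w; rewrite ger0_norm ?cabs_ge0 // -cabs_sqr.
have := sqr_ge0 (cabs (chan n l w) - 1); have := cabs_ge0 (chan n l w); nra.
Qed.

Lemma Ex_cabs_chan n l : Ex (fun w => cabs (chan n l w)) = Ex (fun w => cabs (chan 0 0 w)).
Proof.
pose F (x : R * R) := Num.sqrt ((mu + c * x.1) ^+ 2 + (c * x.2) ^+ 2).
have FE i j w : cabs (chan i j w) = F (complex.Re (g i j w), complex.Im (g i j w)).
  by rewrite /cabs Re_chan Im_chan.
under eq_fun do rewrite FE; under [in RHS]eq_fun do rewrite FE.
apply: Ex_law => [|x]; last exact: sqrtr_ge0.
rewrite (_ : F = Num.sqrt \o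
  (fun x : R * R => (mu + c * x.1) ^+ 2 + (c * x.2) ^+ 2)) //.
apply: measurableT_comp.
  by apply: continuous_measurable_fun; exact: sqrt_continuous.
apply: measurable_funD; apply: measurable_funX.
  by apply: measurable_funD => //; apply: measurable_funM => //; exact: measurable_fst.
by apply: measurable_funM => //; exact: measurable_snd.
Qed.

(** A zero mean would make the channel vanish almost everywhere, against its unit second moment.
    Thus zeta is a genuine inverse. *)
Lemma Ex_cabs_chan_gt0 : 0 < Ex (fun w => cabs (chan 0 0 w)).
Proof.
rewrite lt_def Ex_ge0 ?andbT; last by move=> w; exact: cabs_ge0.
apply/eqP => h0.
have ae0 := Ex_eq0 (intg_cabs_chan 0 0) (fun w => cabs_ge0 _) h0.
have : Ex (fun w => csq (chan 0 0 w)) = 0.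
  rewrite /Ex /Rintegral (ae_eq_integral (cst 0%E)) ?integral0 //.
    exact/measurable_EFinP/intg_measurable/intg_csq_chan.
  apply: filterS ae0 => w /(_ I) /= [] h _.
  by rewrite -cabs_sqr h expr0n.
by rewrite Ex_csq_chan => /eqP; rewrite oner_eq0.
Qed.


(** * Bounds on a limit of normalised optimal values with N antennas *)

Section Limits.
Variables (s v Pw k : R).
Hypotheses (s0 : 0 < s) (v0 : 0 < v) (P0 : 0 < Pw) (k0 : 0 <= k).

Variables (N : nat) (a : forall L : nat, T -> 'cV[C]_L) (e : R).
Let X L w := k * L%:R^-1 * quadform s v (chanmx chan N L w) (a L w).
Hypotheses (aopt : forall L w, is_opt_gain s v Pw (chanmx chan N L w) (a L w))
  (Xe : cvg_in_prob P X e).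

Let kL L : 0 <= k * L%:R^-1.
Proof. by rewrite mulr_ge0 // invr_ge0. Qed.

Let mX L : measurable_fun setT (X L).
Proof.
apply: measurable_funM => //; apply: (opt_measurable s0 v0 P0) (aopt L) => n l.
rewrite (_ : (fun w => _) = chan n l); first exact: cmeasurable_chan.
by apply/funext => w; rewrite mxE.
Qed.

Let X_ge0 L w : 0 <= X L w.
Proof. by rewrite mulr_ge0 // quadform_ge0. Qed.

Lemma opt_limit_ge0 : 0 <= e.
Proof.
apply: (@in_prob_ge _ _ _ _ X e mX Xe (fun _ _ => 0) 0 0 0) => // [L|L _].
  exact: intg_cst.
by rewrite Ex_cst.
Qed.

(* [t / (s t + v / Pw)] is concave in [t]: bound it by its tangent at [t = N]. *)
Lemma opt_limit_le_tangent : e <= k * (N%:R / (s * N%:R + v / Pw)).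
Proof.
set q := v / Pw; have q0 : 0 < q by rewrite divr_gt0.
have N0 : 0 <= N%:R :> R by [].
set r := s * N%:R + q; have r0 : 0 < r by rewrite ltr_wpDl // mulr_ge0 // ltW.
pose t l w := \sum_(n < N) csq (chan n l w).
(* The slope [q / r ^+ 2] is the derivative of t / (s t + q) at t = N. *)
pose tg l w := N%:R / r + (q / r ^+ 2) * (t l w - N%:R).
have it l : intg (t l) by apply: intg_sum => n; exact: intg_csq_chan.
have itN l : intg (fun w => t l w - N%:R) by apply: intgB => //; exact: intg_cst.
have itg l : intg (tg l) by apply: intgD; [exact: intg_cst|exact: intgZ].
have Etg l : Ex (tg l) = N%:R / r.
  rewrite (ExD (intg_cst P _) (intgZ _ (itN l))) Ex_cst (ExZ _ (itN l)).
  rewrite (ExB (it l) (intg_cst P _)) Ex_cst Ex_sum; last by move=> n; exact: intg_csq_chan.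
  under eq_bigr do rewrite Ex_csq_chan.
  by rewrite sumr_const card_ord subrr mulr0 addr0.
pose Y L w := k * L%:R^-1 * \sum_(l < L) tg l w.
have XY L w : X L w <= Y L w.
  rewrite /X /Y ler_wpM2l //.
  have [aP _] := aopt L w.
  apply: le_trans (quadform_le_sensors s0 v0 (chanmx chan N L w) P0 aP) _.
  apply: ler_sum => l _; under eq_bigr do rewrite mxE.
  rewrite -/(t l w) -/q /tg.
  have t0 : 0 <= t l w by apply: sumr_ge0 => n _; exact: csq_ge0.
  have d0 : 0 < s * t l w + q by rewrite ltr_wpDl // mulr_ge0 // ltW.
  rewrite -subr_ge0.
  have -> : N%:R / r + q / r ^+ 2 * (t l w - N%:R) - t l w / (s * t l w + q) =
    s * q * (t l w - N%:R) ^+ 2 / (r ^+ 2 * (s * t l w + q)).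
    by move: d0 r0; rewrite /r => d0 r0; field; rewrite !gt_eqF.
  apply: divr_ge0; first by rewrite mulr_ge0 ?sqr_ge0 ?(ltW (mulr_gt0 s0 q0)).
  by rewrite ltW ?mulr_gt0 ?exprn_gt0.
apply: (@in_prob_le _ _ _ _ X e mX Xe Y _ 1) => // [L|L w|L L0].
- by apply: intgZ; apply: intg_sum.
- exact: le_trans (X_ge0 L w) (XY L w).
rewrite /Y ExZ ?Ex_sum //; last exact: intg_sum.
under eq_bigr do rewrite Etg.
have L0' : 0 < L%:R :> R by rewrite ltr0n.
rewrite sum_ord_const le_eqVlt; apply/orP; left; apply/eqP.
by move: (N%:R / r) => x; field; rewrite gt_eqF.
Qed.

(** Each part is truncated and then recentred: the means stay exactly [mu] and 0, so the
    off-diagonal limits of the Gram matrix do not move, while the variance can only decrease. The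
    level is chosen for the entry (0, 0) and serves every entry by equality of laws. *)
Lemma truncated_parts delta : 0 < delta -> exists (f : bool -> R -> R) (M : R),
  [/\ forall b, measurable_fun setT (f b), forall b x, `|f b x| <= M,
      forall b, Ex (fun w => f b (gpart b 0 0 w)) = if b then mu else 0,
      Ex (fun w => f true (gpart true 0 0 w) ^+ 2)
        + Ex (fun w => f false (gpart false 0 0 w) ^+ 2) <= mu ^+ 2 + c ^+ 2 &
      forall b n l, Ex (fun w => ((if b then mu else 0) + c * gpart b n l w
         - f b (gpart b n l w)) ^+ 2) <= delta].
Proof.
move=> delta0; pose m (b : bool) : R := if b then mu else 0.
have /choice[B BP] : forall b, exists B, 0 <= B /\
    Ex (fun w => (gpart b 0 0 w - trunc B (gpart b 0 0 w)) ^+ 2) <= delta.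
  move=> b; have [||B B0 BP] := @trunc_error _ _ _ P (gpart b 0 0) delta _ _ delta0.
  - exact: measurable_gpart.
  - exact: intg_gpart_sqr.
  - by exists B.
pose tr b w := trunc (B b) (gpart b 0 0 w).
have btr b : bmf (tr b).
  split; last by exists (B b) => w; apply: trunc_bound; case: (BP b).
  exact: (measurableT_comp (measurable_trunc (B b)) (measurable_gpart b 0 0)).
pose tau b := Ex (tr b).
have itr b := bmf_intg P (btr b).
have itr2 b : intg (fun w => tr b w ^+ 2).
  by under eq_fun do rewrite expr2; exact/bmf_intg/bmfM.
have iu b := intg_gpart b 0 0.
pose f b x := m b + c * (trunc (B b) x - tau b).
have mf b : measurable_fun setT (f b).
  apply: measurable_funD => //; apply: measurable_funM => //.
  by apply: measurable_funB => //; exact: measurable_trunc.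
pose M0 b := `|m b| + `|c| * (B b + `|tau b|).
exists f, (M0 true + M0 false); split=> //.
- move=> b x; apply: le_trans (_ : M0 b <= _).
    apply: le_trans (ler_normD _ _) _; rewrite lerD2l normrM ler_wpM2l //.
    apply: le_trans (ler_normB _ _) _; rewrite lerD2r; apply: trunc_bound.
    by case: (BP b).
  have M00 b' : 0 <= M0 b'.
    by have [B0 _] := BP b'; rewrite addr_ge0 ?mulr_ge0 ?addr_ge0.
  by case: b; rewrite ?lerDl ?lerDr.
- move=> b; have i1 := intgB (itr b) (intg_cst P (tau b)).
  rewrite (ExD (intg_cst P _) (intgZ c i1)) Ex_cst (ExZ _ i1).
  by rewrite (ExB (itr b) (intg_cst P _)) Ex_cst subrr mulr0 addr0.
- have Ef2 b : Ex (fun w => f b (gpart b 0 0 w) ^+ 2) <=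
      m b ^+ 2 + c ^+ 2 * Ex (fun w => gpart b 0 0 w ^+ 2).
    have -> : (fun w => f b (gpart b 0 0 w) ^+ 2) = (fun w =>
        (m b - c * tau b) ^+ 2 + ((2 * c * (m b - c * tau b)) * tr b w + c ^+ 2 * tr b w ^+ 2)).
      by apply/funext => w; rewrite /f -/(tr b w); ring.
    have i1 := intgZ (2 * c * (m b - c * tau b)) (itr b).
    have i2 := intgZ (c ^+ 2) (itr2 b).
    rewrite (ExD (intg_cst P _) (intgD i1 i2)) Ex_cst (ExD i1 i2).
    rewrite (ExZ _ (itr b)) (ExZ _ (itr2 b)) -/(tau b).
    have : c ^+ 2 * Ex (fun w => tr b w ^+ 2) <= c ^+ 2 * Ex (fun w => gpart b 0 0 w ^+ 2).
      rewrite ler_wpM2l ?sqr_ge0 //; apply: Ex_le => //; first exact: intg_gpart_sqr.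
      by move=> w; exact: trunc_sqr_le.
    have := sqr_ge0 (c * tau b); nra.
  have := lerD (Ef2 true) (Ef2 false) => /le_trans; apply.
  have := Ex_gpart_sqr 0 0; rewrite /m expr0n add0r -addrA -mulrDr => ->.
  by rewrite mulr1.
- move=> b n l.
  rewrite (@Ex_gpart_law (fun x => (m b + c * x - f b x) ^+ 2) b n l 0 0); last 2 first.
  + apply: measurable_funX; apply: measurable_funB => //.
    by apply: measurable_funD => //; exact: measurable_funM.
  + by move=> x; exact: sqr_ge0.
  have -> : (fun w => (m b + c * gpart b 0 0 w - f b (gpart b 0 0 w)) ^+ 2) = (fun w =>
      (c * tau b) ^+ 2 + ((2 * c ^+ 2 * tau b) * (gpart b 0 0 w - tr b w)
         + c ^+ 2 * (gpart b 0 0 w - tr b w) ^+ 2)).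
    by apply/funext => w; rewrite /f -/(tr b w); ring.
  have i0 := intgB (iu b) (itr b).
  have i1 := intgZ (2 * c ^+ 2 * tau b) i0.
  have i2 : intg (fun w => (gpart b 0 0 w - tr b w) ^+ 2).
    apply: intg_le (intg_gpart_sqr b 0 0) _.
      apply: measurable_funX; exact: (intg_measurable i0).
    by move=> w; rewrite ger0_norm ?sqr_ge0 //; exact: trunc_diff_sqr_le.
  have i3 := intgZ (c ^+ 2) i2.
  rewrite (ExD (intg_cst P _) (intgD i1 i3)) Ex_cst (ExD i1 i3) (ExZ _ i0) (ExZ _ i2).
  rewrite (ExB (iu b) (itr b)) Ex_gpart -/(tau b).
  have [_ h] := BP b.
  (* The factor c^2 is at most 1 by [muc]; recentring only subtracts (c tau)^2 from the mean
     square. *)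
  have : c ^+ 2 * Ex (fun w => (gpart b 0 0 w - tr b w) ^+ 2) <= delta.
    apply: le_trans (ler_wpM2l (sqr_ge0 c) h) _.
    rewrite ler_piMl ?(ltW delta0) //; by rewrite -muc lerDr sqr_ge0.
  have := sqr_ge0 (c * tau b); nra.
Qed.

(** The implication rules out products of the two parts of one entry. For n = m the summands are
    squares of one part; for n <> m two summands with different l involve four distinct entries. In
    both cases independence gives the moments that [mean_concentration] asks for. *)
Lemma gram_concentration (f : bool -> R -> R) (M eta : R) b b' n m :
  (forall b, measurable_fun setT (f b)) -> (forall b x, `|f b x| <= M) -> 0 < eta ->
  (n == m) ==> (b == b') ->
  exists L0, forall L, (L0 <= L)%N ->
    Ex (fun w => `|L%:R^-1 * (\sum_(l < L) f b (gpart b n l w) * f b' (gpart b' m l w))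
      - (if n == m then Ex (fun w => f b (gpart b 0 0 w) ^+ 2)
         else Ex (fun w => f b (gpart b 0 0 w)) * Ex (fun w => f b' (gpart b' 0 0 w)))|) <= eta.
Proof.
move=> mf fM eta0 hnm.
have M0 : 0 <= M by exact: le_trans (fM true 0).
have mfu bb i j : measurable_fun setT (fun w => f bb (gpart bb i j w)).
  by apply: measurableT_comp => //; exact: measurable_gpart.
apply: (@mean_concentration _ _ _ P
  (fun l w => f b (gpart b n l w) * f b' (gpart b' m l w)) (M * M)) => //.
- by move=> l; exact: measurable_funM.
- by move=> l w; rewrite normrM ler_pM.
- move=> l; case: eqP hnm => [<- /= /eqP <-|/eqP nm _].
    have := @Ex_gpart_prod (fun=> b) [:: (n, l)] (fun b x => f b x ^+ 2) (M ^+ 2) isT.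
    rewrite big_seq1 /= => <-.
    + by congr (Ex _); apply/funext => w; rewrite big_seq1 /= expr2.
    + by move=> b0; exact: measurable_funX.
    + by move=> b0 x; rewrite normrX lerXn2r ?nnegrE.
  pose sel (i : nat * nat) := if i.1 == n then b else b'.
  have := @Ex_gpart_prod sel [:: (n, l); (m, l)] f M.
  rewrite /= inE xpair_eqE (negbTE nm) /= => /(_ isT mf fM).
  rewrite !big_cons !big_nil /sel /= eqxx eq_sym (negbTE nm) mulr1 => <-.
  by congr (Ex _); apply/funext => w; rewrite !big_cons big_nil /= eqxx eq_sym (negbTE nm) mulr1.
- move=> l l' ll'; case: eqP hnm => [<- /= /eqP <-|/eqP nm _].
    have := @Ex_gpart_prod (fun=> b) [:: (n, l); (n, l')] (fun b x => f b x ^+ 2) (M ^+ 2).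
    rewrite /= inE xpair_eqE eqxx (negbTE ll') /= => /(_ isT).
    rewrite !big_cons !big_nil /= mulr1 => h; rewrite [RHS]expr2 -h.
    + congr (Ex _); apply/funext => w; rewrite !big_cons big_nil /=; ring.
    + by move=> b0; exact: measurable_funX.
    + by move=> b0 x; rewrite normrX lerXn2r ?nnegrE.
  pose sel (i : nat * nat) := if i.1 == n then b else b'.
  have := @Ex_gpart_prod sel [:: (n, l); (m, l); (n, l'); (m, l')] f M.
  rewrite /= !inE !xpair_eqE !eqxx (negbTE nm) (eq_sym m n) (negbTE nm) (negbTE ll') /=.
  move=> /(_ isT mf fM).
  have mn : (m == n) = false by rewrite eq_sym (negbTE nm).
  rewrite !big_cons !big_nil /sel /= !eqxx !mn mulr1 => h.
  rewrite exprMn !expr2 (_ : forall x y : R, x * x * (y * y) = x * (y * (x * y))); last first.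
    by move=> x y; ring.
  rewrite -h; congr (Ex _); apply/funext => w.
  rewrite !big_cons big_nil /= !eqxx !mn; ring.
Qed.


Lemma opt_limit_le_gram : (0 < N)%N -> e <= k * (Pw / v) * (mu ^+ 2 * N%:R + c ^+ 2).
Proof.
move=> N0; set c0 := mu ^+ 2 * N%:R + c ^+ 2; set k' := k * (Pw / v).
have N1 : 1 <= N%:R :> R by rewrite ler1n.
have c01 : 1 <= c0.
  by rewrite -muc lerD2r ler_peMr // sqr_ge0.
have k'0 : 0 <= k' by rewrite mulr_ge0 // divr_ge0 // ltW.
(* The slack r enters as the Young weight, as the mean Gram error and as the mean truncation cost;
   it tends to 0 at the end. *)
suff main r : 0 < r -> r <= 1 -> e <= k' * ((1 + r) * (c0 + r) + r).
  apply/ler_addgt0Pr => eps eps0.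
  have den : 0 < (k' + 1) * (c0 + 3) by rewrite mulr_gt0 //; lra.
  pose r := Num.min 1 (eps / ((k' + 1) * (c0 + 3))).
  have r0 : 0 < r by rewrite lt_min ltr01 divr_gt0.
  have r1 : r <= 1 by rewrite ge_min lexx.
  have r2 : r * ((k' + 1) * (c0 + 3)) <= eps by rewrite -ler_pdivlMr // ge_min lexx orbT.
  apply: le_trans (main r r0 r1) _.
  have : k' * ((1 + r) * (c0 + r) + r) <= k' * (c0 + r * (c0 + 3)).
    by rewrite ler_wpM2l //; nra.
  have : 0 <= r * (c0 + 3) by rewrite mulr_ge0 ?(ltW r0) //; lra.
  nra.
move=> r0 r1.
(* Summed over N rows and two parts, this residual has mean square r^2 / 2 per sensor; multiplied by
   1 + 1/r, that is at most r. *)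
have delta0 : 0 < r ^+ 2 / (4 * N%:R) by rewrite divr_gt0 ?exprn_gt0 ?mulr_gt0 // ltr0n.
have [f [M [mf fM f1 f2 f3]]] := truncated_parts delta0.
(* There are 4 N^2 averages to control: pairs of antennas times pairs of parts. *)
pose eta := r / (4 * (N%:R * N%:R)).
have eta0 : 0 < eta by rewrite divr_gt0 ?mulr_gt0 // ltr0n.
pose A (b : bool) (n l : nat) (w : T) : R := f b (gpart b n l w).
pose rho (b b' : bool) (n m : nat) : R := if n == m then Ex (fun w => A b 0 0 w ^+ 2)
         else Ex (A b 0 0) * Ex (A b' 0 0).
(* The error is set to 0 for mixed parts of one antenna, whose contributions to h conj(h) cancel. *)
pose D (b b' : bool) (n m L : nat) (w : T) : R := if (n == m) && (b != b') then 0 else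
   `|L%:R^-1 * (\sum_(l < L) A b n l w * A b' m l w) - rho b b' n m|.
have bA b n l : bmf (A b n l).
  split; last by exists M => w; exact: fM.
  exact: (measurableT_comp (mf b) (measurable_gpart b n l)).
have iD b b' n m L : intg (D b b' n m L).
  rewrite /D; case: ((n == m) && (b != b')); first exact: intg_cst.
  apply/intg_abs/bmf_intg/bmfB; last exact: bmf_cst.
  by apply: bmfM; [exact: bmf_cst|apply: bmf_sum => l; exact: bmfM].
have D0 b b' n m L w : 0 <= D b b' n m L w by rewrite /D; case: ifP.
have /choice[L0 L0P] : forall i : bool * bool * ('I_N * 'I_N), exists L0, forall L,
    (L0 <= L)%N -> Ex (D i.1.1 i.1.2 i.2.1 i.2.2 L) <= eta.
  move=> [[b b'] [n m]] /=; case: (boolP ((n == m :> nat) && (b != b'))) => h.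
    by exists 0%N => L _; rewrite /D h Ex_cst ltW.
  have h' : (n == m :> nat) ==> (b == b').
    by move: h; case: (n == m :> nat) => //=; rewrite negbK.
  have [L0 L0P] := gram_concentration mf fM eta0 h'.
  by exists L0 => L /L0P; rewrite /D (negbTE h).
pose Lm := maxn 1 (\max_i L0 i).
pose E L w (n m : 'I_N) := \sum_(b : bool) \sum_(b' : bool) D b b' n m L w.
have E0 L w n m : 0 <= E L w n m.
  by apply: sumr_ge0 => b _; apply: sumr_ge0 => b' _; exact: D0.
have iE n m L : intg (fun w => E L w n m).
  by apply: intg_sum => b; apply: intg_sum => b'; exact: iD.
pose err L w := \sum_n \sum_m E L w n m.
have ierr L : intg (err L).
  by apply: intg_sum => n; apply: intg_sum => m; exact: iE.
have Eerr L : (Lm <= L)%N -> Ex (err L) <= r.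
  move=> LL; rewrite /err Ex_sum; last by move=> n; apply: intg_sum => m; exact: iE.
  have -> : r = \sum_(n < N) \sum_(m < N) \sum_(b : bool) \sum_(b' : bool) eta.
    rewrite !big_bool /= !sum_ord_const /eta.
    by field; rewrite gt_eqF // ltr0n.
  apply: ler_sum => n _; rewrite Ex_sum; last by move=> m; exact: iE.
  apply: ler_sum => m _; rewrite Ex_sum; last by move=> b; apply: intg_sum => b'; exact: iD.
  apply: ler_sum => b _; rewrite Ex_sum; last by move=> b'; exact: iD.
  apply: ler_sum => b' _; apply: (L0P (b, b', (n, m))); apply: leq_trans LL.
  by apply: leq_trans (leq_maxr _ _); exact: (leq_bigmax (b, b', (n, m))).
pose m0 (b : bool) : R := if b then mu else 0.
pose dif (b : bool) (n l : nat) (w : T) : R := m0 b + c * gpart b n l w - A b n l w.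
(* Squared Frobenius norm of the truncation residual, divided by L. It is controlled only in mean,
   which is enough for [in_prob_le]. *)
pose T2 L w := L%:R^-1 * \sum_(l < L) \sum_(n < N) (dif true n l w ^+ 2 + dif false n l w ^+ 2).
have idif b n l : intg (fun w => dif b n l w ^+ 2).
  have [mA _] := bA b n l; have mg' := measurable_gpart b n l.
  have i1 : intg (fun w => 3 * (m0 b ^+ 2 + c ^+ 2 * gpart b n l w ^+ 2 + A b n l w * A b n l w)).
    apply: intgZ; apply: intgD; last exact/bmf_intg/bmfM.
    by apply: intgD; [exact: intg_cst|apply: intgZ; exact: intg_gpart_sqr].
  apply: intg_le i1 _.
    apply: measurable_funX; apply: measurable_funB => //.
    by apply: measurable_funD => //; exact: measurable_funM.
  move=> w; rewrite ger0_norm ?sqr_ge0 // /dif -exprMn.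
  move: (m0 b) (c * _) (A b n l w) => x y z.
  have := sqr_ge0 (x - y); have := sqr_ge0 (x + z); have := sqr_ge0 (y + z); nra.
have iT2 L : intg (T2 L).
  by apply: intgZ; apply: intg_sum => l; apply: intg_sum => n; exact: intgD.
have ET2 L : (0 < L)%N -> Ex (T2 L) <= r ^+ 2 / 2.
  move=> L1; rewrite /T2 ExZ; last by apply: intg_sum => l; apply: intg_sum => n; exact: intgD.
  rewrite Ex_sum; last by move=> l; apply: intg_sum => n; exact: intgD.
  rewrite mulrC ler_pdivrMr ?ltr0n //.
  have -> : r ^+ 2 / 2 * L%:R = \sum_(l < L) \sum_(n < N) (r ^+ 2 / (4 * N%:R) + r ^+ 2 / (4 * N%:R)).
    rewrite !sum_ord_const; field; by rewrite gt_eqF // ltr0n.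
  apply: ler_sum => l _; rewrite Ex_sum; last by move=> n; exact: intgD.
  apply: ler_sum => n _; rewrite ExD //.
  by apply: lerD; [exact: (f3 true)|exact: (f3 false)].
(* Random bound on the largest eigenvalue of H H^H / L, from Young's inequality applied to truncated
   part plus residual. *)
pose Lam L w := (1 + r) * (c0 + err L w) + (1 + r^-1) * T2 L w.
have ri0 : 0 < r^-1 by rewrite invr_gt0.
have err0 L w : 0 <= err L w.
  by apply: sumr_ge0 => n _; apply: sumr_ge0 => m _.
have T20 L w : 0 <= T2 L w.
  rewrite mulr_ge0 ?invr_ge0 //; apply: sumr_ge0 => l _; apply: sumr_ge0 => n _.
  by rewrite addr_ge0 ?sqr_ge0.
have Lam0 L w : 0 < Lam L w.
  apply: ltr_pwDl; last by rewrite mulr_ge0 //; lra.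
  by rewrite mulr_gt0 //; [lra|have := err0 L w; lra].
have beamLam L w y : (0 < L)%N ->
    \sum_l csq (beam (chanmx chan N L w) y l) <= L%:R * Lam L w * sqnormc y.
  move=> L1; have L1' : 0 < L%:R :> R by rewrite ltr0n.
  pose H' : 'M[C]_(N, L) := \matrix_(n, l) (A true n l w +i* A false n l w)%C.
  pose H'' : 'M[C]_(N, L) := \matrix_(n, l) (dif true n l w +i* dif false n l w)%C.
  have HE : chanmx chan N L w = H' + H''.
    apply/matrixP => n l; rewrite !mxE; apply/eqP; rewrite eq_complex Re_chan Im_chan /=.
    by rewrite /dif /m0; apply/andP; split; apply/eqP; ring.
  have bE l : beam (chanmx chan N L w) y l = beam H' y l + beam H'' y l.
    by rewrite HE /beam -big_split /=; apply: eq_bigr => n _; rewrite mxE mulrDr.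
  pose nu := Ex (fun w => A true 0 0 w ^+ 2) + Ex (fun w => A false 0 0 w ^+ 2) - mu ^+ 2.
  have nu_le : nu <= c ^+ 2 by rewrite /nu lerBlDl.
  have rhoD n m : rho true true n m + rho false false n m = mu ^+ 2 + nu * (n == m)%:R.
    rewrite /rho; case: eqP => _; first by rewrite mulr1 /nu [RHS]addrC subrK.
    by rewrite /A !f1 mulr0 addr0 mulr0 addr0 expr2.
  have hE n m : cabs ((L%:R^-1)%:C%C * (\sum_l H' n l * ((H' m l)^*)%C)
     - ((mu ^+ 2 + nu * (n == m)%:R)%:C)%C) <= E L w n m.
    have ReZ (x : R) (z : C) : complex.Re ((x%:C)%C * z) = x * complex.Re z.
      by case: z => p q /=; rewrite mul0r subr0.
    have ImZ (x : R) (z : C) : complex.Im ((x%:C)%C * z) = x * complex.Im z.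
      by case: z => p q /=; rewrite mul0r addr0.
    have eN : (n == m) = ((n : nat) == m) by [].
    apply: le_trans (cabs_le_ReIm _) _; rewrite ReD ImD ReZ ImZ Re_sum Im_sum /= oppr0 addr0.
    have -> : \sum_l complex.Re (H' n l * ((H' m l)^*)%C) =
        \sum_(l < L) A true n l w * A true m l w + \sum_(l < L) A false n l w * A false m l w.
      by rewrite -big_split; apply: eq_bigr => l _; rewrite !mxE /=; ring.
    have -> : \sum_l complex.Im (H' n l * ((H' m l)^*)%C) =
        \sum_(l < L) A false n l w * A true m l w - \sum_(l < L) A true n l w * A false m l w.
      by rewrite -sumrB; apply: eq_bigr => l _; rewrite !mxE /=; ring.
    have EE : E L w n m = (D true true n m L w + D false false n m L w)
        + (D false true n m L w + D true false n m L w).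
      by rewrite /E !big_bool /=; ring.
    rewrite EE eN -rhoD; apply: lerD.
      rewrite /D /= !andbF mulrDr opprD addrACA; exact: ler_normD.
    (* Imaginary part: for n = m the two sums coincide and cancel; for n <> m both limits are 0, as
       [f false] has mean 0. *)
    rewrite /D /= !andbT; case: eqP => [nm|/eqP nm].
      rewrite -nm addr0 (_ : _ - _ = 0) ?mulr0 ?normr0 //.
      by apply/eqP; rewrite subr_eq0; apply/eqP; apply: eq_bigr => l _; rewrite mulrC.
    rewrite /rho (negbTE nm) /A !f1 mul0r mulr0 !subr0 mulrBr; exact: ler_normB.
  have h1 := beam_gram_le y L1 (sqr_ge0 mu) hE.
  have h2 : \sum_l csq (beam H'' y l) <= L%:R * T2 L w * sqnormc y.
    rewrite /T2 mulVKf ?gt_eqF // mulr_suml; apply: ler_sum => l _.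
    rewrite mulrC; apply: le_trans (csq_beam_le H'' y l) _.
    by rewrite ler_wpM2l ?sqnormc_ge0 //; apply: ler_sum => n _; rewrite mxE.
  apply: le_trans (_ : (1 + r) * (\sum_l csq (beam H' y l))
     + (1 + r^-1) * (\sum_l csq (beam H'' y l)) <= _).
    rewrite !mulr_sumr -big_split /=; apply: ler_sum => l _.
    by rewrite bE; exact: csqD_Young.
  have h3 : L%:R * (mu ^+ 2 * N%:R + nu + \sum_n \sum_m E L w n m) * sqnormc y
      <= L%:R * (c0 + err L w) * sqnormc y.
    rewrite ler_wpM2r ?sqnormc_ge0 // ler_wpM2l ?(ltW L1') //.
    by rewrite lerD2r lerD2l.
  have r1' : 0 <= 1 + r by lra.
  have r2' : 0 <= 1 + r^-1 by lra.
  have -> : L%:R * Lam L w * sqnormc y = (1 + r) * (L%:R * (c0 + err L w) * sqnormc y)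
     + (1 + r^-1) * (L%:R * T2 L w * sqnormc y) by rewrite /Lam; ring.
  apply: lerD; rewrite ler_wpM2l //; exact: le_trans h1 h3.
pose Y L w := k' * Lam L w.
have XY L w : X L w <= Y L w.
  (* For L = 0 the convention [0^-1 = 0] makes X vanish. *)
  case: (posnP L) => [->|L1]; first by rewrite /X invr0 mulr0 mul0r mulr_ge0 // ltW.
  have L1' : 0 < L%:R :> R by rewrite ltr0n.
  have [aP _] := aopt L w.
  have := quadform_le_gram s0 v0 P0 (mulr_gt0 L1' (Lam0 L w)) aP (fun y => beamLam L w y L1).
  move=> h; rewrite /X; apply: le_trans (ler_wpM2l (kL L) h) _.
  rewrite le_eqVlt /Y /k'; apply/orP; left; apply/eqP.
  by field; rewrite !gt_eqF.
have iLam1 L : intg (fun w => (1 + r) * (c0 + err L w)).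
  by apply: intgZ; apply: intgD => //; exact: intg_cst.
have iLam2 L : intg (fun w => (1 + r^-1) * T2 L w) by exact: intgZ.
have iLam L : intg (Lam L) by exact: intgD.
apply: (@in_prob_le _ _ _ _ X e mX Xe Y _ Lm) => // [L|L w|L LL].
- exact: intgZ.
- by rewrite mulr_ge0 // ltW.
rewrite /Y ExZ // ler_wpM2l // (ExD (iLam1 L) (iLam2 L)).
rewrite (ExZ _ (intgD (intg_cst P c0) (ierr L))) (ExD (intg_cst P c0) (ierr L)) Ex_cst.
rewrite (ExZ _ (iT2 L)).
have L1 : (0 < L)%N by apply: leq_trans LL; rewrite leq_maxl.
apply: lerD; first by rewrite ler_wpM2l ?lerD2l ?Eerr //; lra.
have r2' : 0 <= 1 + r^-1 by lra.
apply: le_trans (ler_wpM2l r2' (ET2 L L1)) _.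
have -> : (1 + r^-1) * (r ^+ 2 / 2) = r * ((r + 1) / 2) by field; rewrite gt_eqF.
by rewrite ler_piMr ?(ltW r0) //; lra.
Qed.

End Limits.

(* Cauchy-Schwarz in the linearised form
   [t / (s t + q) >= 2 x sqrt t - x^2 (s t + q)], then an optimal [x]. *)
Lemma opt1_limit_ge (s v Pw k : R) (a : forall L : nat, T -> 'cV[C]_L) (e : R) :
  0 < s -> 0 < v -> 0 < Pw -> 0 <= k ->
  (forall L w, is_opt_gain s v Pw (chanmx chan 1 L w) (a L w)) ->
  cvg_in_prob P (fun L w => k * L%:R^-1 * quadform s v (chanmx chan 1 L w) (a L w)) e ->
  k * (Ex (fun w => cabs (chan 0 0 w)) ^+ 2 / (s + v / Pw)) <= e.
Proof.
move=> s0 v0 P0 k0 aopt Xe.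
set q := v / Pw; have q0 : 0 < q by rewrite divr_gt0.
set kap := Ex _.
(* Maximiser of the mean 2 x kap - x^2 (s + q) of [Z], using the unit second moment of the
   channel. *)
pose x := kap / (s + q).
have sq0 : 0 < s + q by exact: addr_gt0.
pose Z l w := 2 * x * cabs (chan 0 l w) - x ^+ 2 * (s * csq (chan 0 l w) + q).
have i1 l := intgZ (2 * x) (intg_cabs_chan 0 l).
have i3 l := intgZ s (intg_csq_chan 0 l).
have i4 l := intgD (i3 l) (intg_cst P q).
have i2 l := intgZ (x ^+ 2) (i4 l).
have iZ l : intg (Z l) by exact: intgB (i1 l) (i2 l).
have EZ l : Ex (Z l) = kap ^+ 2 / (s + q).
  rewrite (ExB (i1 l) (i2 l)) (ExZ _ (intg_cabs_chan 0 l)) (ExZ _ (i4 l)).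
  rewrite (ExD (i3 l) (intg_cst P q)) Ex_cst (ExZ _ (intg_csq_chan 0 l)) Ex_csq_chan.
  by rewrite Ex_cabs_chan -/kap /x; field; rewrite gt_eqF.
have d0 l w : 0 < s * csq (chan 0 l w) + q.
  by rewrite ltr_wpDl // mulr_ge0 ?csq_ge0 // ltW.
have Zphi l w : Z l w <= csq (chan 0 l w) / (s * csq (chan 0 l w) + q).
  have := d0 l w; rewrite /Z -!cabs_sqr; move: (cabs _) => y dy.
  rewrite -subr_ge0.
  have -> : y ^+ 2 / (s * y ^+ 2 + q) - (2 * x * y - x ^+ 2 * (s * y ^+ 2 + q)) =
    (y - x * (s * y ^+ 2 + q)) ^+ 2 / (s * y ^+ 2 + q) by field; rewrite gt_eqF.
  by rewrite divr_ge0 ?sqr_ge0 // ltW.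
(* Supplies the uniform upper bound k / s that [in_prob_ge] requires. *)
have phis l w : csq (chan 0 l w) / (s * csq (chan 0 l w) + q) <= s^-1.
  rewrite ler_pdivrMr // mulrDr mulKf ?gt_eqF // lerDl.
  by rewrite mulr_ge0 ?invr_ge0 // ltW.
pose Y L w := k * L%:R^-1 * \sum_(l < L) Z l w.
have kL L : 0 <= k * L%:R^-1 by rewrite mulr_ge0 // invr_ge0.
have mX L : measurable_fun setT
    (fun w => k * L%:R^-1 * quadform s v (chanmx chan 1 L w) (a L w)).
  apply: measurable_funM => //; apply: (opt_measurable s0 v0 P0) (aopt L) => n l.
  rewrite (_ : (fun w => _) = chan n l); first exact: cmeasurable_chan.
  by apply/funext => w; rewrite mxE.
apply: (@in_prob_ge _ _ _ _ _ e mX Xe Y _ (k / s) 1) => [|L|L w|L w|L L1].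
- by rewrite divr_ge0 // ltW.
- by apply: intgZ; exact: intg_sum.
- apply: le_trans (_ : k * L%:R^-1 * \sum_(l < L) s^-1 <= _).
    by rewrite ler_wpM2l //; apply: ler_sum => l _; exact: le_trans (Zphi l w) (phis l w).
  rewrite sum_ord_const.
  case: (posnP L) => [->|L1]; first by rewrite mul0r mulr0 divr_ge0 // ltW.
  by rewrite mulrA mulfVK // gt_eqF // ltr0n.
- rewrite ler_wpM2l //; apply: le_trans (quadform_opt1_ge s0 v0 P0 (aopt L w)).
  by apply: ler_sum => l _; rewrite mxE; exact: Zphi.
rewrite /Y ExZ ?Ex_sum //; last exact: intg_sum.
under eq_bigr do rewrite EZ.
have L0' : 0 < L%:R :> R by rewrite ltr0n.
rewrite sum_ord_const le_eqVlt; apply/orP; left; apply/eqP.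
by move: (kap ^+ 2 / (s + q)) => y; field; rewrite gt_eqF.
Qed.

End Model.

Theorem theorem2 (R : realType) (d : measure_display) (T : measurableType d)
  (P : probability T R)
  (hdiff : nat -> nat -> T -> R[i])      (* diffuse channel components h^diff_{nl} *)
  (N : nat) (theta p1 s_eta2 s_nu2 PT K : R)
  (alphaN : forall L : nat, T -> 'cV[R[i]]_L)   (* alpha_OPT for N antennas *)
  (alpha1 : forall L : nat, T -> 'cV[R[i]]_L)   (* alpha_OPT for 1 antenna  *)
  (EN E1 : R) :                                 (* E_CSIS(N), E_CSIS(1) *)
  let h := fun n l w =>
    ((Num.sqrt (K / (K + 1)))%:C + ((Num.sqrt (K + 1))^-1)%:C * hdiff n l w)%C in
  let Pw := PT / (p1 * theta ^+ 2 + s_eta2) in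
  let gs := theta ^+ 2 / s_eta2 in
  let gc := PT / s_nu2 in
  let z := gc / (p1 * gs + 1) in
  let E_AWGN1 := 8^-1 * (gc * gs / (gc + p1 * gs + 1)) in
  let zeta := (fine (\int[P]_w (cabs (h 0%N 0%N w))%:E)%E) ^- 2 in
  (0 < N)%N -> 0 < theta -> 0 < p1 < 1 -> 0 < s_eta2 -> 0 < s_nu2 -> 0 < PT -> 0 <= K ->
  (forall n l, cmeasurable (hdiff n l)) ->
  cindep P (fun nl : nat * nat => hdiff nl.1 nl.2) ->
  cident P (fun nl : nat * nat => hdiff nl.1 nl.2) ->
  (forall n l, P.-integrable setT
     (fun w => (complex.Re (hdiff n l w) ^+ 2 + complex.Im (hdiff n l w) ^+ 2)%:E)) ->
  (forall n l, (\int[P]_w (complex.Re (hdiff n l w))%:E = 0)%E) ->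
  (forall n l, (\int[P]_w (complex.Im (hdiff n l w))%:E = 0)%E) ->
  (forall n l, (\int[P]_w (complex.Re (hdiff n l w) ^+ 2
                           + complex.Im (hdiff n l w) ^+ 2)%:E = 1)%E) ->
  (forall L w, is_opt_gain s_eta2 s_nu2 Pw (chanmx h N L w) (alphaN L w)) ->
  (forall L w, is_opt_gain s_eta2 s_nu2 Pw (chanmx h 1 L w) (alpha1 L w)) ->
  cvg_in_prob P (fun L w => theta ^+ 2 / 8 * L%:R^-1
                   * quadform s_eta2 s_nu2 (chanmx h N L w) (alphaN L w)) EN ->
  cvg_in_prob P (fun L w => theta ^+ 2 / 8 * L%:R^-1
                   * quadform s_eta2 s_nu2 (chanmx h 1 L w) (alpha1 L w)) E1 ->
  EN / E1 <= zeta * (EN / E_AWGN1) /\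
  zeta * (EN / E_AWGN1) <=
    zeta * Num.min (N%:R * (z + 1) / (N%:R * z + 1)) ((z + 1) * ((N%:R * K + 1) / (K + 1))).
Proof.
move=> h Pw gs gc z E_AWGN1 zeta N0 th0 /andP[p0 p1'] s0 v0 PT0 K0 mg ig eg sg zRe zIm oneg
  optN opt1 cN c1.
have K1 : 0 < K + 1 by lra.
pose mu := Num.sqrt (K / (K + 1)); pose c := (Num.sqrt (K + 1))^-1.
have mu2 : mu ^+ 2 = K / (K + 1) by rewrite sqr_sqrtr // divr_ge0 // ltW.
have c2 : c ^+ 2 = (K + 1)^-1 by rewrite /c exprVn sqr_sqrtr // ltW.
have muc : mu ^+ 2 + c ^+ 2 = 1 by rewrite mu2 c2; field; rewrite gt_eqF.
have zRe' n l : Ex P (fun w => complex.Re (hdiff n l w)) = 0.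
  by rewrite /Ex /Rintegral zRe.
have zIm' n l : Ex P (fun w => complex.Im (hdiff n l w)) = 0.
  by rewrite /Ex /Rintegral zIm.
have oneg' n l : Ex P (fun w => csq (hdiff n l w)) = 1.
  by rewrite /Ex /Rintegral oneg.
have den0 : 0 < p1 * theta ^+ 2 + s_eta2.
  by rewrite addr_gt0 // mulr_gt0 // exprn_gt0.
have P0 : 0 < Pw by rewrite divr_gt0.
pose k := theta ^+ 2 / 8.
have k0 : 0 < k by rewrite divr_gt0 // exprn_gt0.
have EN0 := opt_limit_ge0 (mu := mu) (c := c) mg s0 v0 P0 (ltW k0) optN cN.
have hN1 := opt_limit_le_tangent muc mg sg zRe' zIm' oneg' s0 v0 P0 (ltW k0) optN cN.
have hN2 := opt_limit_le_gram muc mg ig eg sg zRe' zIm' oneg' s0 v0 P0 (ltW k0) optN cN N0.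
have h1 := opt1_limit_ge muc mg eg sg zRe' zIm' oneg' s0 v0 P0 (ltW k0) opt1 c1.
have kap0 := Ex_cabs_chan_gt0 muc mg sg zRe' zIm' oneg'.
set kap := Ex P _ in h1 kap0.
have zetaE : zeta = kap ^- 2 by [].
set q := s_nu2 / Pw in hN1 h1.
have q0 : 0 < q by rewrite divr_gt0.
have sq0 : 0 < s_eta2 + q by rewrite addr_gt0.
have zE : z = s_eta2 / q.
  by rewrite /z /gc /gs /q /Pw; field; rewrite !lt0r_neq0.
have EAE : E_AWGN1 = k / (s_eta2 + q).
  rewrite /E_AWGN1 /gc /gs /q /Pw /k; field.
  by rewrite !lt0r_neq0 // addr_gt0 // mulr_gt0.
have PvE : Pw / s_nu2 = q^-1 by rewrite /q invf_div.
have EA0 : 0 < E_AWGN1 by rewrite EAE divr_gt0.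
have N0' : 0 < N%:R :> R by rewrite ltr0n.
split.
  (* The lower bound on [E1] is positive, so [E1] can be inverted; EN >= 0 then allows passing to
     the smaller denominator. *)
  have E10 : 0 < E_AWGN1 * kap ^+ 2 by rewrite mulr_gt0 // exprn_gt0.
  have le1 : E_AWGN1 * kap ^+ 2 <= E1.
    by apply: le_trans h1; rewrite EAE mulrAC mulrA.
  rewrite zetaE mulrCA -invfM ler_wpM2l // mulrC lef_pV2 ?posrE //.
  exact: lt_le_trans E10 le1.
rewrite ler_wpM2l ?zetaE ?invr_ge0 ?sqr_ge0 // le_min; apply/andP; split.
  (* In terms of [k], [s_eta2] and [q] the remaining inequality is an identity; the same holds for
     the second bound. *)
  rewrite ler_pdivrMr //; apply: le_trans hN1 _; rewrite EAE zE le_eqVlt.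
  apply/orP; left; apply/eqP; field.
  by rewrite !gt_eqF //= addr_gt0 // mulr_gt0.
rewrite ler_pdivrMr //; apply: le_trans hN2 _; rewrite EAE zE mu2 c2 PvE le_eqVlt.
apply/orP; left; apply/eqP; field.
by rewrite !gt_eqF.
Qed.
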